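(* There is an absolute constant $c>0$ such that the following holds. Let $p_1=p_1(n)$ and $p_2=p_2(n)$ be functions of $n$ with values in $[0,1]$. For each $n$ let $(V,E_1)=\mathcal{G}(n,p_1)$ and $(V,E_2)=\mathcal{G}(n,p_2)$ be independent Erdős–Rényi random graphs on the same vertex set $V=[n]$, and let $G=(V,E_1,E_2)$ be the corresponding double graph. (i) If $p_1p_2\leq \dfrac{1}{c\,n\log n}$ (for all sufficiently large $n$), then $\mathbb{P}(G \text{ percolates})\to 0$ as $n\to\infty$. (ii) If $p_1p_2\geq \dfrac{c}{n\log n}$ and $\min\{p_1,p_2\}\geq \dfrac{c\log n}{n}$ (for all sufficiently large $n$), then $\mathbb{P}(G \text{ percolates})\to 1$ as $n\to\infty$.
   Context: Write $[n]=\{1,\dots,n\}$. $\mathcal{G}(n,p)$ is the random graph on $[n]$ in which each of the $\binom n2$ pairs is an edge independently with probability $p$. A double graph is an ordered triple $G=(V,E_1,E_2)$ where $V$ is a finite set and $E_1,E_2$ are sets of (unordered) pairs of distinct elements of $V$. Jigsaw percolation with input $G$ evolves at discrete times $t=0,1,\dots$. At time $0$ the partition $\mathcal{C}_0$ of $V$ consists of all singletons. Given the partition $\mathcal{C}_t=\{C_t^1,\dots,C_t^{k_t}\}$ of $V$, let $\mathcal{G}_t$ be the graph with vertex set $\mathcal{C}_t$ in which distinct parts $C_t^i,C_t^j$ are adjacent if there exist edges $e_1\in E_1$ and $e_2\in E_2$ such that $e_\ell\cap C_t^k\neq\emptyset$ for each of the four choices of $\ell\in\{1,2\}$ and $k\in\{i,j\}$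 (that is, the two parts are joined by at least one edge of $E_1$ and at least one edge of $E_2$). If $\mathcal{G}_t$ has no edges, the process stops. Otherwise $\mathcal{C}_{t+1}$ is the partition of $V$ whose parts are the unions of the parts of $\mathcal{C}_t$ in each connected component of $\mathcal{G}_t$; if $|\mathcal{C}_{t+1}|=1$ the process stops, and otherwise it continues. The double graph $G$ percolates if the final partition is $\{V\}$. *)

(* Defs.v *)
From HB Require Import structures.
From mathcomp Require Import all_boot all_order all_algebra.
From mathcomp Require Import all_classical all_reals all_analysis.

Set Implicit Arguments.
Unset Strict Implicit.
Unset Printing Implicit Defensive.

Import Order.TTheory GRing.Theory Num.Theory.
Local Open Scope ring_scope.

Definition edge (V : finType) := {e : {set V} | #|e| == 2%N}.

Record double_graph := DoubleGraph {
  vertex : finType;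
  edges1 : {set edge vertex};
  edges2 : {set edge vertex}
}.

Definition joined (V : finType) (E : {set edge V}) (A B : {set V}) : bool :=
  [exists e in E, (val e :&: A != finset.set0) && (val e :&: B != finset.set0)].

Section Jigsaw.
Variable G : double_graph.
Local Notation V := (vertex G).

Definition jigsaw_init : {set {set V}} := [set [set x] | x : V].

(* The adjacency relation of the graph on the parts of the partition [C];
   it is false outside [C]. *)
Definition jigsaw_adj (C : {set {set V}}) : rel {set V} := fun A B =>
  [&& A \in C, B \in C, A != B, joined (edges1 G) A B & joined (edges2 G) A B].

Definition jigsaw_merge (C : {set {set V}}) : {set {set V}} :=
  [set finset.cover [set B in C | connect (jigsaw_adj C) A B] | A in C].

Definition jigsaw_stops (C : {set {set V}}) : bool :=
  ~~ [exists A, exists B, jigsaw_adj C A B] || (#|C| == 1%N).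

(* Once the process has stopped, the partition stays frozen. *)
Definition jigsaw_step (C : {set {set V}}) : {set {set V}} :=
  if jigsaw_stops C then C else jigsaw_merge C.

Definition jigsaw_part (t : nat) : {set {set V}} :=
  iter t jigsaw_step jigsaw_init.

Definition percolates : Prop :=
  exists2 t : nat, jigsaw_stops (jigsaw_part t) &
                   jigsaw_part t = [set [set: V]].

End Jigsaw.

(* The law of G(n, p), with vertex set {0, ..., n-1}: the product over all
   pairs of the Bernoulli(p) laws of their indicators. *)
Definition gnp_law (R : realType) (n : nat) (p : R) (E : {set edge 'I_n}) : R :=
  \prod_(e : edge 'I_n) (if e \in E then p else 1 - p).

Definition gnp2_prob (R : realType) (n : nat) (p1 p2 : R)
    (Q : double_graph -> Prop) : R :=
  \sum_(E : {set edge 'I_n} * {set edge 'I_n} | `[< Q (DoubleGraph E.1 E.2) >])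
    gnp_law p1 E.1 * gnp_law p2 E.2.

(* Main.v *)
Require Import Defs.
From HB Require Import structures.
From mathcomp Require Import all_classical all_reals all_analysis.
From mathcomp Require Import all_boot all_order all_algebra.
From mathcomp Require Import zify ring lra.

(** A pair of random graphs is treated as one random set of coloured edges, a
    product of Bernoulli measures on a finite index set. Write l for the integer
    part of the base 2 logarithm of n; every error term below is O(1 / l).

    Subcritical part. Each cluster of the process is connected in both graphs,
    and clusters only grow by unions of adjacent clusters. So if the process
    percolates then, for each scale L at most n, adding clusters one at a time
    meets a set of size between L and 2L that is connected in both graphs
    ([percolates_doubly_connected]). A connected set of size k contains a rooted
    spanning tree, which is coded by a parent function, so the set is connected
    in a graph of density p with probability at most (k p) ^ (k - 1)
    ([pr_cut_connected]). The union bound over the sets of size k costs a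
    binomial coefficient, at most (4 n / k) ^ k, so the sum over k is a
    geometric one of ratio at most 8 L n p1 p2, started at the power L - 1. With
    L = l and p1 p2 at most a small multiple of 1 / (n ln n), it beats the
    factor n ([pr_percolates_le]).

    Supercritical part. A cluster of a vertices absorbs each outside vertex that
    has a neighbour in it in both graphs, an event of probability about
    a ^ 2 p1 p2 for each of the order of n available vertices. We grow a cluster
    by successive layers: layer A is a set of 2 ^ j vertices known to be in one
    cluster, and the next layer consists of 2 ^ (j + 1) vertices of a reserve W
    that are attached to A in both colours. Whether such a layer exists, and
    which one is taken, depends only on the edges between A and W, so the edges
    inside W remain independent of what was seen: this is what makes the
    successive layers independent, and it also allows restarting from a fresh
    vertex of W after a failure ([fail_step]).

    Below the seed level, where 2 ^ I is a small multiple of ln n, each layer is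
    an atypical event, but the product of the probabilities of the first I
    layers is at least 2 ^ (- l / 4), so 2 ^ (l / 2) attempts contain a
    successful one with high probability ([fail_early]). Above the seed level
    the expected size of the next layer exceeds the required one by a constant
    factor, and a Chernoff bound makes the failure probability of level j at
    most 2 ^ (- j - 1) ([fail_late]).

    The layers are grown inside a set Y of about half of the vertices, and lead
    to a subset of Y of linear size inside one cluster. It depends only on the
    edges inside Y, so every vertex outside Y is attached to it, by edges
    leaving Y and independent of it, because both densities are at least a large
    multiple of ln n / n; the remaining vertices of Y are in turn attached to
    the complement of Y ([not_percolates_le]). *)

Set Implicit Arguments.
Unset Strict Implicit.
Unset Printing Implicit Defensive.

Import Order.TTheory GRing.Theory Num.Theory.
Local Open Scope ring_scope.

(** * Product Bernoulli measures on finite sets *)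

Section ProductBernoulli.
Variables (R : realFieldType) (I : finType) (p : I -> R).
Hypothesis p01 : forall i, 0 <= p i <= 1.

Definition bweight (S : {set I}) : R :=
  \prod_i (if i \in S then p i else 1 - p i).

Definition expect (f : {set I} -> R) : R := \sum_S bweight S * f S.

Definition pr (Q : {set I} -> bool) : R := expect (fun S => (Q S)%:R).

(** Measurability with respect to the coordinates in [J]. *)
Definition depends_on (J : {set I}) (T : Type) (f : {set I} -> T) :=
  forall S S' : {set I}, S :&: J = S' :&: J -> f S = f S'.

Lemma sum_set_prod (F G : I -> R) :
  \sum_(S : {set I}) \prod_i (if i \in S then F i else G i)
    = \prod_i (F i + G i).
Proof. by rewrite bigA_distr; apply: eq_bigl => S; rewrite inE. Qed.

Lemma bweight_ge0 S : 0 <= bweight S.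
Proof.
apply: prodr_ge0 => i _; case: ifP => _; last rewrite subr_ge0;
by have /andP[] := p01 i.
Qed.

Lemma expect_cst c : expect (fun=> c) = c.
Proof.
rewrite /expect -mulr_suml -[X in _ = X]mul1r; congr (_ * _).
by rewrite sum_set_prod big1 // => i _; ring.
Qed.

Lemma eq_expect f g : f =1 g -> expect f = expect g.
Proof. by move=> fg; apply: eq_bigr => S _; rewrite fg. Qed.

Lemma le_expect f g : (forall S, f S <= g S) -> expect f <= expect g.
Proof. by move=> fg; apply: ler_sum => S _; rewrite ler_wpM2l ?bweight_ge0. Qed.

Lemma expectD f g : expect (fun S => f S + g S) = expect f + expect g.
Proof. by rewrite -big_split; apply: eq_bigr => S _; rewrite mulrDr. Qed.

Lemma expectZl c f : expect (fun S => c * f S) = c * expect f.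
Proof. by rewrite mulr_sumr; apply: eq_bigr => S _; rewrite mulrCA. Qed.

Lemma expectB f g : expect (fun S => f S - g S) = expect f - expect g.
Proof.
rewrite expectD -mulN1r -expectZl; congr (_ + _).
by apply: eq_expect => S; rewrite mulN1r.
Qed.

Lemma expect_sum (T : finType) (P : pred T) (f : T -> {set I} -> R) :
  expect (fun S => \sum_(x | P x) f x S) = \sum_(x | P x) expect (f x).
Proof.
rewrite exchange_big; apply: eq_bigr => S _; exact: mulr_sumr.
Qed.

Lemma pr_ge0 Q : 0 <= pr Q.
Proof. by rewrite -(expect_cst 0); apply: le_expect => S; rewrite ler0n. Qed.

Lemma pr_le1 Q : pr Q <= 1.
Proof. by rewrite -[leRHS](expect_cst 1); apply: le_expect => S; rewrite lern1 leq_b1. Qed.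

Lemma le_pr (P Q : {set I} -> bool) : (forall S, P S -> Q S) -> pr P <= pr Q.
Proof.
move=> PQ; apply: le_expect => S; rewrite ler_nat.
by case: (P S) (PQ S) => // ->.
Qed.

Lemma pr_compl Q : pr (fun S => ~~ Q S) = 1 - pr Q.
Proof.
rewrite -[X in _ = X - _](expect_cst 1) -expectB; apply: eq_expect => S.
by case: (Q S); rewrite ?subrr ?subr0.
Qed.

Lemma pr_orD P Q : pr (fun S => P S || Q S) <= pr P + pr Q.
Proof.
rewrite -expectD; apply: le_expect => S.
by case: (P S); case: (Q S) => /=; rewrite -natrD ler_nat.
Qed.

Lemma pr_union (T : finType) (A : pred T) (Q : T -> {set I} -> bool) :
  pr (fun S => [exists x in A, Q x S]) <= \sum_(x in A) pr (Q x).
Proof.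
rewrite -expect_sum; apply: le_expect => S.
case: existsP => [[x /andP[xA Qx]]|_]; last by rewrite sumr_ge0.
by rewrite (bigD1 x) //= Qx lerDl sumr_ge0.
Qed.

(** A subset of the index set is the same as a pair of a subset of [J] and one
    of its complement, which turns the sum of products into a product of sums. *)
Lemma sum_split_set (J : {set I}) (F G : {set I} -> R) :
  depends_on J F -> depends_on (~: J) G ->
  \sum_S F S * G S
    = (\sum_(A : {set I} | A \subset J) F A)
      * (\sum_(B : {set I} | B \subset ~: J) G B).
Proof.
move=> dF dG; rewrite big_distrlr /=.
rewrite pair_big_dep /=.
rewrite (reindex_onto (fun S => (S :&: J, S :\: J))
           (fun AB : {set I} * {set I} => AB.1 :|: AB.2)) /=; last first.
  move=> [A B] /= /andP[AJ BJ]; congr (_, _).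
    rewrite setIUl (setIidPl AJ); apply/setUidPl.
    by have := setSI J BJ; rewrite [~: J :&: _]setIC setICr => /subset_trans -> //; exact: sub0set.
  rewrite setDUl; have /eqP -> : A :\: J == set0 by rewrite setD_eq0.
  by rewrite set0U setDE; apply/setIidPl.
apply: eq_big => [S|S _].
  by rewrite subsetIr setDE subsetIr -setIUr setUCr setIT eqxx.
by congr (_ * _); [apply: dF|apply: dG]; rewrite ?setDE -setIA setIid.
Qed.

Lemma depends_onM J f g :
  depends_on J f -> depends_on J g -> depends_on J (fun S => f S * g S : R).
Proof. by move=> df dg S S' e; rewrite (df _ _ e) (dg _ _ e). Qed.

Lemma depends_on_comp (T U : Type) J (h : T -> U) f :
  depends_on J f -> depends_on J (fun S => h (f S)).
Proof. by move=> df S S' e; rewrite (df _ _ e). Qed.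

(** The weight of [S] is the product of its weights on [J] and off [J], so both
    sides factor, and the total masses of the two factors have product 1. *)
Lemma expect_indep (J : {set I}) f g :
  depends_on J f -> depends_on (~: J) g ->
  expect (fun S => f S * g S) = expect f * expect g.
Proof.
move=> df dg.
pose w (K S : {set I}) := \prod_(i in K) (if i \in S then p i else 1 - p i).
have dw K : depends_on K (w K).
  move=> S S' e; apply: eq_bigr => i iK.
  by have := congr1 (fun X : {set I} => i \in X) e; rewrite /= !inE iK !andbT => ->.
have wE S : bweight S = w J S * w (~: J) S.
  rewrite /bweight (bigID (mem J)) /=; congr (_ * _).
  by apply: eq_bigl => i; rewrite inE.
have split h k : depends_on J h -> depends_on (~: J) k ->
    expect (fun S => h S * k S)
      = (\sum_(A : {set I} | A \subset J) w J A * h A)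
        * (\sum_(B : {set I} | B \subset ~: J) w (~: J) B * k B).
  move=> dh dk; rewrite -(sum_split_set (depends_onM (@dw _) dh) (depends_onM (@dw _) dk)).
  by apply: eq_bigr => S _; rewrite wE; ring.
have d1 K : depends_on K (fun=> 1 : R) by [].
have e1 := split _ _ (d1 J) (d1 (~: J)).
have ef := split _ _ df (d1 (~: J)).
have eg := split _ _ (d1 J) dg.
have simp1 h : expect (fun S => h S * 1) = expect h.
  by apply: eq_expect => S; rewrite mulr1.
have simp2 h : expect (fun S => 1 * h S) = expect h.
  by apply: eq_expect => S; rewrite mul1r.
rewrite simp1 expect_cst in e1; rewrite simp1 in ef; rewrite simp2 in eg.
have cancel (x a b y : R) : 1 = a * b -> x * y = x * b * (a * y).
  by move=> ab1; rewrite -[LHS]mulr1 ab1; ring.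
by rewrite split // ef eg; exact: cancel.
Qed.

Lemma pr_indep (J : {set I}) (P Q : {set I} -> bool) :
  depends_on J P -> depends_on (~: J) Q ->
  pr (fun S => P S && Q S) = pr P * pr Q.
Proof.
move=> dP dQ.
rewrite -(expect_indep (depends_on_comp (fun b : bool => b%:R) dP)
                       (depends_on_comp (fun b : bool => b%:R) dQ)).
by apply: eq_expect => S; rewrite -mulnb natrM.
Qed.

(** Conditioning on a random object [kappa] that only sees the coordinates in
    [J]: in a quantity that otherwise only sees the other coordinates, [kappa]
    may be frozen at each of its values. *)
Lemma expect_freeze (T : finType) (J : {set I}) (kappa : {set I} -> T)
    (g : T -> {set I} -> R) (b : T -> R) :
  depends_on J kappa -> (forall x, depends_on (~: J) (g x)) ->
  (forall x, expect (g x) <= b x) ->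
  expect (fun S => g (kappa S) S) <= expect (fun S => b (kappa S)).
Proof.
move=> dk dg gb.
have slice (h : T -> {set I} -> R) S :
    h (kappa S) S = \sum_x (kappa S == x)%:R * h x S.
  rewrite (bigD1 (kappa S)) //= eqxx mul1r big1 ?addr0 // => x.
  by rewrite eq_sym => /negPf ->; rewrite mul0r.
have dx x : depends_on J (fun S => (kappa S == x)%:R : R).
  exact: (depends_on_comp (fun y => (y == x)%:R) dk).
rewrite (eq_expect (slice g)) (eq_expect (slice (fun x _ => b x))).
rewrite !expect_sum; apply: ler_sum => x _.
rewrite (expect_indep (dx x) (dg x)) (@expect_indep J _ (fun=> b x)) // expect_cst.
by rewrite ler_wpM2l // pr_ge0.
Qed.

Lemma pr_superset (D : {set I}) : pr (fun S => D \subset S) = \prod_(i in D) p i.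
Proof.
have e S : bweight S * (D \subset S)%:R
    = \prod_i (if i \in S then p i else if i \in D then 0 else 1 - p i).
  have [/subsetP DS|] := boolP (D \subset S).
    rewrite mulr1; apply: eq_bigr => i _.
    by case: ifPn => // iS; case: ifPn => // /DS; rewrite (negPf iS).
  by case/subsetPn => i iD iS; rewrite mulr0 (bigD1 i) //= (negPf iS) iD mul0r.
rewrite /pr /expect (eq_bigr _ (fun S _ => e S)).
rewrite sum_set_prod [RHS]big_mkcond /=; apply: eq_bigr => i _.
by case: ifP => _; [rewrite addr0 | ring].
Qed.

Lemma pr_disjoint (D : {set I}) :
  pr (fun S => [disjoint D & S]) = \prod_(i in D) (1 - p i).
Proof.
have e S : bweight S * [disjoint D & S]%:R
    = \prod_i (if i \in S then (if i \in D then 0 else p i) else 1 - p i).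
  have [DS|/pred0Pn[i]] := boolP [disjoint D & S].
    rewrite mulr1; apply: eq_bigr => i _.
    by case: ifPn => // iS; case: ifPn => // iD; rewrite (disjointFr DS iD) in iS.
  by case/andP => /= iD iS; rewrite mulr0 (bigD1 i) // iS iD /= mul0r.
rewrite /pr /expect (eq_bigr _ (fun S _ => e S)).
rewrite sum_set_prod [RHS]big_mkcond /=; apply: eq_bigr => i _.
by case: ifP => _; ring.
Qed.

End ProductBernoulli.

(** * Lower bounds for binomial tails *)

Section BinomialTail.
Variables (R : realFieldType) (r : R).
Hypothesis r01 : 0 <= r <= 1.

(** The probability that [N] independent trials of success probability [r] give
    at least [k] successes, through the outcome of the first trial. *)
Fixpoint btail (N k : nat) : R :=
  match k, N with
  | 0%N, _ => 1
  | _, 0%N => 0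
  | k'.+1, N'.+1 => r * btail N' k' + (1 - r) * btail N' k
  end.

Lemma btail0 N : btail N 0 = 1. Proof. by case: N. Qed.

Lemma btailSS N k :
  btail N.+1 k.+1 = r * btail N k + (1 - r) * btail N k.+1.
Proof. by []. Qed.

Lemma btail_itv N k : 0 <= btail N k <= 1.
Proof.
have /andP[r0 r1] := r01.
elim: N k => [|N IH] [|k]; rewrite ?btail0 ?ler01 ?lexx //=.
have /andP[a0 a1] := IH k; have /andP[b0 b1] := IH k.+1.
by apply/andP; split; nra.
Qed.

Lemma btail_anti N k : btail N k.+1 <= btail N k.
Proof.
have /andP[r0 r1] := r01.
elim: N k => [|N IH] [|k].
- by rewrite btail0 /= ler01.
- by [].
- by rewrite btail0; have /andP[] := btail_itv N.+1 1.
by rewrite !btailSS; apply: lerD; rewrite ler_wpM2l ?subr_ge0.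
Qed.

Lemma btail_mono N N' k : (N <= N')%N -> btail N k <= btail N' k.
Proof.
have /andP[r0 r1] := r01.
move=> /subnK <-; elim: (N' - N)%N => [//|d IH]; apply: (le_trans IH).
case: k {IH} => [|k]; first by rewrite !btail0.
rewrite addSn btailSS; have := btail_anti (d + N) k; nra.
Qed.

(** Markov's inequality for 2 ^ (k - X), with X the number of successes, since
    2 ^ (- X) has expectation (1 - r / 2) ^ N. *)
Lemma btail_chernoff N k : 1 - 2 ^+ k * (1 - r / 2) ^+ N <= btail N k.
Proof.
have /andP[r0 r1] := r01.
have q0 M : 0 <= (1 - r / 2) ^+ M by apply: exprn_ge0; lra.
elim: N k => [|N IH] [|k]; rewrite ?btail0.
- by rewrite !expr0; lra.
- by rewrite /= expr0 mulr1 subr_le0 exprn_ege1 // ler1n.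
- by rewrite expr0 mul1r; have := q0 N.+1; lra.
rewrite btailSS; have := IH k; have := IH k.+1.
rewrite !exprS; set P := 2 ^+ k; set Q := (1 - r / 2) ^+ N => h1 h2.
suff -> : 1 - 2 * P * ((1 - r / 2) * Q)
   = r * (1 - P * Q) + (1 - r) * (1 - 2 * P * Q).
  by apply: lerD; rewrite ler_wpM2l ?subr_ge0.
by field.
Qed.

Lemma btail_block m N k :
  (1 - (1 - r) ^+ m) * btail N k <= btail (m + N) k.+1.
Proof.
have /andP[r0 r1] := r01.
elim: m => [|m IH].
  by rewrite expr0 subrr mul0r; have /andP[] := btail_itv (0 + N) k.+1.
rewrite addSn btailSS exprS.
have := btail_mono k (leq_addl m N); set B := btail (m + N) k => hB.
have -> : (1 - (1 - r) * (1 - r) ^+ m) * btail N k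
   = r * btail N k + (1 - r) * ((1 - (1 - r) ^+ m) * btail N k) by ring.
by apply: lerD; rewrite ler_wpM2l ?subr_ge0.
Qed.

(** Divide the trials into [k] blocks of length [m] and ask for a success in
    each block. *)
Lemma btail_power m k : (1 - (1 - r) ^+ m) ^+ k <= btail (k * m) k.
Proof.
have /andP[r0 r1] := r01.
elim: k => [|k IH]; first by rewrite btail0.
rewrite mulSn exprS; apply: le_trans (btail_block _ _ _).
apply: ler_wpM2l => //; rewrite subr_ge0; apply: exprn_ile1; lra.
Qed.

End BinomialTail.

(** * Probability of a hit in several trials *)

Section Miss.
Variables (R : realFieldType).

Lemma bernoulli_le (x : R) m : -1 <= x -> 1 + m%:R * x <= (1 + x) ^+ m.
Proof.
move=> x1; elim: m => [|m IH]; first by rewrite expr0 mul0r addr0.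
rewrite exprS -natr1; have : 0 <= (1 + x) by lra.
move/ler_wpM2l => /(_ _ _ IH); apply: le_trans.
have : 0 <= m%:R * x ^+ 2 :> R by rewrite mulr_ge0 ?sqr_ge0.
rewrite expr2; nra.
Qed.

Lemma miss_le_inv (x : R) m : 0 <= x <= 1 -> (1 - x) ^+ m * (1 + m%:R * x) <= 1.
Proof.
move=> /andP[x0 x1].
have q0 : 0 <= (1 - x) ^+ m by apply: exprn_ge0; lra.
have := bernoulli_le m (_ : -1 <= x); move=> /(_ ltac:(lra)) h.
apply: le_trans (ler_wpM2l q0 h) _; rewrite -exprMn.
by apply: exprn_ile1; nra.
Qed.

(** A union bound is sharp up to a factor 2 as long as it is at most 1. *)
Lemma hit_ge (x y : R) m : 0 <= x <= 1 -> y <= 1 -> y <= m%:R * x ->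
  y / 2 <= 1 - (1 - x) ^+ m.
Proof.
move=> x01 y1 yx; have := miss_le_inv m x01.
have /andP[x0 x1] := x01.
have q0 : 0 <= (1 - x) ^+ m by apply: exprn_ge0; lra.
have mx0 : 0 <= m%:R * x by rewrite mulr_ge0.
set q := (1 - x) ^+ m in q0 *; set t := m%:R * x in yx mx0 * => h.
have [t1|t1] := leP t 1; nra.
Qed.

(** Each factor is at least half the minimum of 1 and [b] times the density;
    the four hypotheses are the four ways of expanding the product of these two
    minima. *)
Lemma hit_hit_ge (x x' z N : R) b : 0 <= x <= 1 -> 0 <= x' <= 1 -> 0 <= N ->
  4 * z <= N -> 4 * z <= N * (b%:R * x) -> 4 * z <= N * (b%:R * x') ->
  4 * z <= N * (b%:R * x * (b%:R * x')) ->
  z <= N * ((1 - (1 - x) ^+ b) * (1 - (1 - x') ^+ b)).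
Proof.
move=> hx hx' N0 z1 z2 z3 z4.
have bx : 0 <= b%:R * x by rewrite mulr_ge0 //; case/andP: hx.
have bx' : 0 <= b%:R * x' by rewrite mulr_ge0 //; case/andP: hx'.
have H1 : Num.min 1 (b%:R * x) / 2 <= 1 - (1 - x) ^+ b.
  by apply: hit_ge; rewrite // ge_min lexx ?orbT.
have H2 : Num.min 1 (b%:R * x') / 2 <= 1 - (1 - x') ^+ b.
  by apply: hit_ge; rewrite // ge_min lexx ?orbT.
have K1 : 0 <= Num.min 1 (b%:R * x) by rewrite le_min ler01.
have K2 : 0 <= Num.min 1 (b%:R * x') by rewrite le_min ler01.
have H : Num.min 1 (b%:R * x) / 2 * (Num.min 1 (b%:R * x') / 2)
    <= (1 - (1 - x) ^+ b) * (1 - (1 - x') ^+ b).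
  by apply: ler_pM => //; rewrite divr_ge0.
apply: le_trans (ler_wpM2l N0 H).
by rewrite !minEle; case: ifP => _; case: ifP => _; lra.
Qed.

End Miss.

(** * Connected sets and parent functions *)

Section Joined.
Variables (V : finType).
Implicit Types (E : {set edge V}) (A B X Y : {set V}).

Lemma joinedP E A B :
  reflect (exists e : edge V, [/\ e \in E, exists2 a, a \in val e & a \in A &
                                  exists2 b, b \in val e & b \in B])
          (joined E A B).
Proof.
apply: (iffP existsP) => [[e /and3P[eE /set0Pn[a] /setIP[ae aA] /set0Pn[b] /setIP[be bB]]]|].
  by exists e; split=> //; [exists a|exists b].
case=> e [eE [a ae aA] [b be bB]]; exists e; rewrite eE /=.
by apply/andP; split; apply/set0Pn; [exists a|exists b]; rewrite inE ?ae ?be.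
Qed.

Lemma joined_sym E A B : joined E A B = joined E B A.
Proof. by apply: eq_existsb => e; rewrite [X in _ && X]andbC. Qed.

Lemma joined_sub E E' A A' B B' :
  E \subset E' -> A \subset A' -> B \subset B' ->
  joined E A B -> joined E' A' B'.
Proof.
move=> /subsetP EE /subsetP AA /subsetP BB /joinedP[e [eE [a ae aA] [b be bB]]].
by apply/joinedP; exists e; split; [exact: EE|exists a; auto|exists b; auto].
Qed.

Lemma edge_set2 (e : edge V) a b :
  a \in val e -> b \in val e -> a != b -> val e = [set a; b].
Proof.
move=> ae be ab; apply/esym/eqP; rewrite eqEcard subUset !sub1set ae be /=.
by rewrite (eqP (valP e)) cards2 ab.
Qed.

(** Connectivity through cuts: this form is stable under unions of adjacent
    sets without any discussion of paths. *)
Definition cut_connected E X :=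
  [forall Y : {set V}, (Y \proper X) && (Y != set0) ==> joined E Y (X :\: Y)].

Lemma cut_connected1 E x : cut_connected E [set x].
Proof.
apply/forallP => Y; apply/implyP => /andP[/proper_card].
by rewrite cards1 ltnS leqn0 cards_eq0 => ->.
Qed.

(** A cut of the union that splits neither [A] nor [B] separates [A] from [B],
    and is crossed by the edge that joins them. *)
Lemma cut_connectedU E A B : cut_connected E A -> cut_connected E B ->
  joined E A B -> cut_connected E (A :|: B).
Proof.
move=> cA cB jAB; apply/forallP => Y; apply/implyP => /andP[YAB Y0].
have cut (Z : {set V}) : Z \subset A :|: B -> cut_connected E Z -> Z :&: Y != set0 ->
    ~~ (Z \subset Y) -> joined E Y ((A :|: B) :\: Y).
  move=> ZAB /forallP/(_ (Z :&: Y))/implyP cZ ZY0 ZY.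
  have /cZ : (Z :&: Y \proper Z) && (Z :&: Y != set0).
    by rewrite ZY0 andbT properE subsetIl subsetI subxx.
  by apply: joined_sub; rewrite ?subsetIr // setDIr setDv set0U setSD.
have [AY0|AY0] := eqVneq (A :&: Y) set0; have [BY0|BY0] := eqVneq (B :&: Y) set0.
- by move: Y0; rewrite -(setIidPr (proper_sub YAB)) setIUl AY0 BY0 setU0 eqxx.
- have [BY|BY] := boolP (B \subset Y); last exact: (cut B (subsetUr _ _)).
  rewrite joined_sym; apply: joined_sub jAB => //.
  by rewrite subsetD subsetUl /= -setI_eq0 AY0.
- have [AY|AY] := boolP (A \subset Y); last exact: (cut A (subsetUl _ _)).
  by apply: joined_sub jAB => //; rewrite subsetD subsetUr /= -setI_eq0 BY0.
have [BY|BY] := boolP (B \subset Y); last exact: (cut B (subsetUr _ _)).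
have [AY|AY] := boolP (A \subset Y); last exact: (cut A (subsetUl _ _)).
by case/andP: YAB => _; rewrite subUset AY BY.
Qed.

Definition parent_edges (f : {ffun V -> V}) (D : {set V}) : {set edge V} :=
  [set e : edge V | [exists x in D, val e == [set x; f x]]].

(** A spanning tree, as a map sending each vertex other than the root to its
    parent. That the edges are pairwise distinct is recorded by their number,
    which is what the probability estimate uses. The map has
    the default value [r] outside [X :\ r], so that such maps are counted by
    their values on [X :\ r] only. The tree is grown from [r], one crossing edge
    at a time. *)
Lemma cut_connected_parent E X r : r \in X -> cut_connected E X ->
  exists f : {ffun V -> V},
    [/\ f \in pffun_on r (mem (X :\ r)) (mem X), #|parent_edges f (X :\ r)| = #|X|.-1
      & parent_edges f (X :\ r) \subset E].
Proof.
move=> rX cX.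
suff grow k : (k < #|X|)%N -> exists Y : {set V}, exists f : {ffun V -> V},
    [/\ r \in Y, Y \subset X & #|Y| = k.+1] /\
    [/\ f \in pffun_on r (mem (Y :\ r)) (mem Y), #|parent_edges f (Y :\ r)| = k
      & parent_edges f (Y :\ r) \subset E].
  have X0 : (0 < #|X|)%N by rewrite (cardD1 r) rX.
  have [|Y [f [[rY YX cY] tree]]] := grow #|X|.-1; first by rewrite prednK.
  have YE : Y = X by apply/eqP; rewrite eqEcard YX cY prednK /=.
  by exists f; rewrite -{1 3 4}YE; rewrite YE in tree *.
elim: k => [|k IH] kX.
  exists [set r], [ffun=> r]; rewrite set11 sub1set rX cards1 setDv.
  have -> : parent_edges [ffun=> r] set0 = set0.
    by apply/setP => e; rewrite !inE; apply/existsP => -[x]; rewrite inE.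
  split; first by [].
  rewrite cards0 sub0set; split=> //; apply/pffun_onP; split.
    by apply/subsetP => x; rewrite !inE ffunE eqxx.
  by move=> y /imageP[x]; rewrite inE.
have [Y [f [[rY YX cY] [/pffun_onP[fs fim] ce eE]]]] := IH (ltnW kX).
have YpX : Y \proper X by rewrite properEcard YX cY.
have Y0 : Y != set0 by apply/set0Pn; exists r.
have /joinedP[e [eE' [x xe xY] [y ye]]] := implyP (forallP cX Y) (introT andP (conj YpX Y0)).
case/setDP => yX yY.
have yr : y != r by apply: contraNneq yY => ->.
have yx : y != x by apply: contraNneq yY => ->.
have ev : val e = [set y; x] by apply: edge_set2.
pose g := [ffun z => if z == y then x else f z].
have fY z : z \in Y -> f z \in Y.
  move=> zY; have [->|zr] := eqVneq (f z) r; first by [].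
  apply: fim; apply: image_f.
  by apply: (subsetP fs); rewrite inE.
have gY z : z \in Y -> g z = f z by move=> zY; rewrite ffunE; case: eqP => // zy; rewrite -zy zY in yY.
have eN : e \notin parent_edges f (Y :\ r).
  rewrite inE; apply/existsP => -[z /andP[/setD1P[_ zY] /eqP ez]].
  by move: ye; rewrite ez !inE => /orP[]/eqP yz; rewrite yz ?zY ?fY // in yY.
have peE : parent_edges g ((y |: Y) :\ r) = e |: parent_edges f (Y :\ r).
  apply/setP => e'; rewrite !inE; apply/existsP/orP => [[z]|[/eqP ->|/existsP[z]]].
  - rewrite !inE => /andP[/andP[zr /orP[/eqP ->|zY]] /eqP e'z].
      by left; apply/eqP/val_inj; rewrite e'z ev ffunE eqxx.
    by right; apply/existsP; exists z; rewrite !inE zr zY /= e'z gY.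
  - by exists y; rewrite !inE yr eqxx /= ev ffunE eqxx.
  by rewrite !inE => /andP[/andP[zr zY] /eqP e'z]; exists z; rewrite !inE zr zY orbT /= e'z gY.
exists (y |: Y), g; split.
  by rewrite inE rY orbT subUset sub1set yX YX cardsU1 yY cY add1n.
rewrite peE cardsU1 eN ce add1n; split=> //; last by rewrite subUset sub1set eE' eE.
apply/pffun_onP; split.
  apply/subsetP => z; rewrite !inE ffunE; have [-> _|zy fz] := eqVneq z y; first by rewrite yr.
  by have := subsetP fs z; rewrite !inE => /(_ fz) /andP[-> ->].
move=> w /imageP[z]; rewrite !inE => /andP[zr zY] ->.
rewrite ffunE; have [_|zy] := eqVneq z y; first by rewrite xY orbT.
by rewrite (negPf zy) /= in zY; rewrite fY ?orbT.
Qed.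

End Joined.

(** * Structure of the jigsaw process *)

Section Process.
Variable G : double_graph.
Local Notation V := (vertex G).
Implicit Types (C F : {set {set V}}) (A B D X : {set V}).

Lemma jigsaw_adj_sym C : symmetric (jigsaw_adj C).
Proof.
move=> A B; rewrite /jigsaw_adj eq_sym !(joined_sym _ A).
by case: (A \in C); case: (B \in C).
Qed.

Local Notation component C A := [set B in C | connect (jigsaw_adj C) A B].

Lemma component_refl C A : A \in C -> A \in component C A.
Proof. by rewrite inE connect0 andbT. Qed.

Lemma jigsaw_merge_partition C :
  partition C [set: V] -> partition (jigsaw_merge C) [set: V].
Proof.
case/and3P => /eqP cC tC n0C; apply/and3P; split.
- rewrite eqEsubset subsetT /=; apply/subsetP => x xV.
  have xC : x \in cover C by rewrite cC.
  apply/bigcupP; exists (cover (component C (pblock C x))).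
    by apply: imset_f; exact: pblock_mem.
  by apply/bigcupP; exists (pblock C x); rewrite ?component_refl ?mem_pblock ?pblock_mem.
- apply/trivIsetP => _ _ /imsetP[A AC ->] /imsetP[A' A'C ->].
  apply: contraNT => /pred0Pn[x /andP[/= /bigcupP[B] + xB /bigcupP[B']]].
  rewrite !inE => /andP[BC AB] /andP[B'C A'B'] xB'.
  have BB' : B = B' by rewrite -(def_pblock tC BC xB) (def_pblock tC B'C xB').
  subst B'; apply/eqP; congr cover; apply/setP => D; rewrite !inE; congr (_ && _).
  have cs := sym_connect_sym (@jigsaw_adj_sym C).
  by rewrite (same_connect cs AB) (same_connect cs A'B').
apply/imsetP => -[A AC e]; have /set0Pn[x xA] : A != set0.
  by apply: contraNneq n0C => <-.
have : x \in cover (component C A).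
  by apply/bigcupP; exists A; rewrite ?component_refl.
by rewrite -e inE.
Qed.

Lemma jigsaw_init_partition : partition (jigsaw_init G) [set: V].
Proof.
apply/and3P; split.
- rewrite eqEsubset subsetT /=; apply/subsetP => x _.
  by apply/bigcupP; exists [set x]; rewrite ?set11 ?imset_f.
- apply/trivIsetP => _ _ /imsetP[x _ ->] /imsetP[y _ ->] xy.
  by rewrite disjoints1 inE; apply: contra_neqN xy => /eqP ->.
by apply/imsetP => -[x _ /setP/(_ x)]; rewrite !inE eqxx.
Qed.

Lemma jigsaw_part_partition t : partition (jigsaw_part G t) [set: V].
Proof.
elim: t => [|t IH]; first exact: jigsaw_init_partition.
by rewrite /jigsaw_part iterS /jigsaw_step; case: ifP => // _; exact: jigsaw_merge_partition.
Qed.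

Lemma card_jigsaw_merge C A B : jigsaw_adj C A B -> (#|jigsaw_merge C| < #|C|)%N.
Proof.
move=> AB; rewrite ltn_neqAle leq_imset_card andbT.
apply/negP => /imset_injP inj.
have /and5P[AC BC AnB _ _] := AB.
case/eqP: AnB; apply: inj => //; congr cover; apply/setP => D; rewrite !inE.
by rewrite (same_connect (sym_connect_sym (@jigsaw_adj_sym C)) (connect1 AB)).
Qed.

Lemma jigsaw_eventually_stops : exists t, jigsaw_stops (jigsaw_part G t).
Proof.
have [m] := ubnP #|jigsaw_part G 0|; move: (0%N).
elim: m => // m IH t tm.
have [|stop] := boolP (jigsaw_stops (jigsaw_part G t)); first by exists t.
apply: (IH t.+1).
rewrite /jigsaw_part iterS /jigsaw_step -/(jigsaw_part G t) (negPf stop).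
move: stop; rewrite negb_or negbK => /andP[/existsP[A /existsP[B AB]] _].
exact: leq_trans (card_jigsaw_merge AB) _.
Qed.

(** The process always stops, at a partition without adjacent parts; such
    partitions are easier to reason about than the process itself. *)
Lemma percolates_stable :
  (0 < #|V|)%N ->
  (forall F, partition F [set: V] -> (forall A B, ~~ jigsaw_adj F A B) ->
     F = [set [set: V]]) ->
  percolates G.
Proof.
move=> V0 H; have [t st] := jigsaw_eventually_stops; exists t => //.
have pt := jigsaw_part_partition t.
case/orP: st => [st|/cards1P[D FD]].
  by apply: H => // A B; apply: contra st => AB; apply/existsP; exists A; apply/existsP; exists B.
move: (cover_partition pt); rewrite FD => <-; congr [set _].
by rewrite /cover big_set1.
Qed.

Definition doubly_connected X :=
  cut_connected (edges1 G) X && cut_connected (edges2 G) X.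

Lemma doubly_connectedU A B : doubly_connected A -> doubly_connected B ->
  joined (edges1 G) A B -> joined (edges2 G) A B -> doubly_connected (A :|: B).
Proof.
by case/andP=> a1 a2 /andP[b1 b2] j1 j2; rewrite /doubly_connected !cut_connectedU.
Qed.

(** Inside a component of the graph on the parts, a maximal family of parts
    containing [A] whose union is doubly connected and smaller than [L] must be
    the whole component: one more adjacent part keeps the union doubly connected
    and makes it smaller than [2 L], hence smaller than [L] as there is no
    intermediate size. This replaces the simultaneous merging of the process by
    merging parts one at a time. *)
Lemma small_components L C :
  (forall X, doubly_connected X -> (#|X| < L.*2)%N -> (#|X| < L)%N) ->
  (forall A, A \in C -> doubly_connected A && (#|A| < L)%N) ->
  forall A, A \in jigsaw_merge C -> doubly_connected A && (#|A| < L)%N.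
Proof.
move=> gap small _ /imsetP[A AC ->].
pose P (D : {set {set V}}) := [&& A \in D, D \subset component C A, doubly_connected (cover D)
              & (#|cover D| < L)%N].
have PA : P [set A].
  by rewrite /P set11 sub1set component_refl //= /cover big_set1 small.
have [D /maxsetP[/and4P[AD DC gD sD] maxD] _] := maxset_exists PA.
have stepD B B' : B \in D -> jigsaw_adj C B B' -> B' \in D.
  move=> BD BB'; have /and5P[BC B'C _ j1 j2] := BB'.
  have Bsub : B \subset cover D by exact: bigcup_sup.
  have coverU : cover (B' |: D) = cover D :|: B'.
    by rewrite /cover bigcup_setU big_set1 setUC.
  have /andP[gB' sB'] := small B' B'C.
  have gU : doubly_connected (cover D :|: B').
    by apply: doubly_connectedU => //; [move: j1|move: j2]; apply: joined_sub.
  suff : P (B' |: D) by move/maxD => <-; rewrite ?subsetUr ?setU11.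
  rewrite /P coverU gU inE AD orbT subUset DC sub1set !inE B'C /=.
  rewrite gap // ?andbT; last first.
    apply: leq_ltn_trans (leq_card_setU _ _) _.
    by rewrite -addnn -addSn leq_add // ltnW.
  move: (subsetP DC _ BD); rewrite inE => /andP[_ /connect_trans]; apply.
  exact: connect1.
suff -> : component C A = D by rewrite gD sD.
apply/eqP; rewrite eqEsubset DC andbT; apply/subsetP => B; rewrite inE => /andP[_].
case/connectP => p pth ->.
elim: p A AD pth {AC P PA DC maxD} => //= B' p IH A AD /andP[AB' pth].
by apply: IH pth; exact: stepD AB'.
Qed.

Lemma percolates_doubly_connected L :
  (1 < L)%N -> (L <= #|V|)%N -> percolates G ->
  exists X, [/\ doubly_connected X, (L <= #|X|)%N & (#|X| < L.*2)%N].
Proof.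
move=> L1 LV [t _ pt].
have [/existsP[X /and3P[]]|none] := boolP [exists X, [&& doubly_connected X, L <= #|X| & #|X| < L.*2]%N].
  by exists X.
suff : forall A, A \in jigsaw_part G t -> doubly_connected A && (#|A| < L)%N.
  by move=> /(_ [set: V]); rewrite pt set11 cardsT => /(_ isT)/andP[_]; rewrite ltnNge LV.
elim: t {pt} => [|t IH].
  by move=> _ /imsetP[x _ ->]; rewrite cards1 L1 andbT /doubly_connected !cut_connected1.
rewrite /jigsaw_part iterS /jigsaw_step; case: ifP => // _.
apply: small_components => // X gX sX; rewrite ltnNge; apply: contra none => LX.
by apply/existsP; exists X; rewrite gX LX.
Qed.

End Process.

(** * Search for a large cluster by layers *)

Section Coloured.
Variable V : finType.
Local Notation cedge := (bool * edge V)%type.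
Implicit Types (S : {set cedge}) (A B D W X : {set V}).

Definition colour (b : bool) S : {set edge V} := [set e | (b, e) \in S].

Definition two_colours S : double_graph := DoubleGraph (colour true S) (colour false S).

Definition attached S A v :=
  joined (colour true S) [set v] A && joined (colour false S) [set v] A.

Definition inside X : {set cedge} := [set i : cedge | val i.2 \subset X].

Lemma colour_sub S S' b : S \subset S' -> colour b S \subset colour b S'.
Proof. by move=> /subsetP SS; apply/subsetP => e; rewrite !inE => /SS. Qed.

(** The partitions at which the process can come to rest. *)
Definition stable S (F : {set {set V}}) :=
  partition F [set: V] /\ forall A B, ~~ @jigsaw_adj (two_colours S) F A B.

Lemma stable_sub S S' F : S \subset S' -> stable S' F -> stable S F.
Proof.
move=> SS [pF st]; split=> // A B; apply: contra (st A B).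
rewrite /jigsaw_adj /= => /and5P[-> -> -> j1 j2] /=.
by apply/andP; split; [move: j1|move: j2]; apply: joined_sub; rewrite ?colour_sub.
Qed.

Lemma stable_absorb S F D A v : stable S F -> D \in F -> A \subset D ->
  attached S A v -> v \in D.
Proof.
move=> [pF st] DF AD /andP[j1 j2]; have [/eqP cF tF _] := and3P pF.
have vF : v \in cover F by rewrite cF.
have vP : [set v] \subset pblock F v by rewrite sub1set mem_pblock.
have [<-|ne] := eqVneq (pblock F v) D; first by rewrite mem_pblock.
have := st (pblock F v) D; rewrite /jigsaw_adj /= pblock_mem // DF ne /=.
by rewrite (joined_sub (subxx _) vP AD j1) (joined_sub (subxx _) vP AD j2).
Qed.

(** Certainly contained in a single final part; unlike membership in the final
    part of a given vertex, this is visibly monotone in the edge set. *)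
Definition clumped S A := forall F, stable S F -> exists2 D, D \in F & A \subset D.

Lemma clumped_sub S S' A : S \subset S' -> clumped S A -> clumped S' A.
Proof. by move=> SS cA F /(stable_sub SS) /cA. Qed.

Lemma clumped1 S v : clumped S [set v].
Proof.
move=> F [/and3P[/eqP cF _ _] _]; have vF : v \in cover F by rewrite cF.
by exists (pblock F v); rewrite ?pblock_mem // sub1set mem_pblock.
Qed.

Lemma clumped_attached S A B : {in B, forall v, attached S A v} ->
  clumped S A -> clumped S B.
Proof.
move=> AB cA F sF; have [D DF AD] := cA F sF; exists D => //.
by apply/subsetP => v vB; apply: stable_absorb sF DF AD (AB v vB).
Qed.

(** Everything is absorbed in two steps: first the complement of [Y], by [X],
    then [Y], by its complement. *)
Lemma clumped_percolates S X Y : (0 < #|V|)%N -> clumped S X ->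
  {in ~: Y, forall v, attached S X v} ->
  {in Y, forall v, attached S (~: Y) v} ->
  percolates (two_colours S).
Proof.
move=> V0 cX aX aY; apply: percolates_stable => // F pF st.
have sF : stable S F by [].
have [D DF XD] := cX F sF.
have YD : ~: Y \subset D.
  by apply/subsetP => v vY; apply: stable_absorb sF DF XD (aX v vY).
have DT : D = [set: V].
  apply/eqP; rewrite eqEsubset subsetT /=; apply/subsetP => v _.
  have [vY|vY] := boolP (v \in Y); first exact: stable_absorb sF DF YD (aY v vY).
  by apply: (subsetP YD); rewrite inE.
apply/eqP; rewrite eqEsubset sub1set /= -{2}DT DF andbT.
apply/subsetP => B BF; rewrite inE -DT.
have /and3P[_ /trivIsetP tF n0F] := pF.
apply: contraT => /(tF _ _ BF DF); rewrite DT -setI_eq0 setIT => /eqP B0.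
by rewrite B0 (negPf n0F) in BF.
Qed.

(** The exploration: [A] is the current layer and [W] the reserve of vertices
    not used so far. Earlier layers are forgotten, so that [search] only sees
    edges inside [A :|: W]. On a failure the exploration may start again from
    any vertex of the reserve. *)
Inductive search (t : nat) S : {set V} -> {set V} -> Prop :=
| search_done A W : (t <= #|A|)%N -> search t S A W
| search_grow A W B : B \subset W -> {in B, forall v, attached S A v} ->
    search t S B (W :\: B) -> search t S A W
| search_restart A W s : s \in W -> search t S [set s] (W :\ s) -> search t S A W.

Lemma search_clumped t S A W : search t S A W -> clumped S A ->
  exists X, [/\ X \subset A :|: W, (t <= #|X|)%N & clumped S X].
Proof.
elim=> {A W} [A W tA|A W B BW aB _ IH|A W s sW _ IH] cA.
- by exists A; rewrite subsetUl.
- have [X [XB tX cX]] := IH (clumped_attached aB cA).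
  exists X; split=> //; apply: (subset_trans XB).
  by rewrite subUset (subset_trans BW (subsetUr _ _)) (subset_trans (subsetDl _ _) (subsetUr _ _)).
have [X [XB tX cX]] := IH (@clumped1 S s); exists X; split=> //.
apply: (subset_trans XB); rewrite subUset sub1set inE sW orbT /=.
exact: subset_trans (subsetDl _ _) (subsetUr _ _).
Qed.

Lemma joined_edge S b v A : v \notin A ->
  joined (colour b S) [set v] A ->
  exists e : edge V, [/\ (b, e) \in S, v \in val e & exists2 a, a \in A & val e = [set v; a]].
Proof.
move=> vA /joinedP[e [eE [w we /set1P wv] [a ae aA]]]; subst w.
rewrite inE in eE; exists e; split=> //; exists a => //.
by apply: edge_set2 => //; apply: contraNneq vA => ->.
Qed.

Lemma joined_ext S S' b v A : v \notin A ->
  (forall e : edge V, v \in val e -> val e \subset v |: A -> (b, e) \in S -> (b, e) \in S') ->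
  joined (colour b S) [set v] A -> joined (colour b S') [set v] A.
Proof.
move=> vA SS /(joined_edge vA)[e [eS ve [a aA ev]]].
apply/joinedP; exists e; split.
- by rewrite inE; apply: SS; rewrite // ev subUset !sub1set !inE eqxx aA orbT.
- by exists v; rewrite ?set11.
by exists a; rewrite // ev !inE eqxx orbT.
Qed.

Lemma attached_ext S S' v A (K : {set cedge}) : v \notin A ->
  (forall b (e : edge V), v \in val e -> val e \subset v |: A -> (b, e) \in K) ->
  S :&: K = S' :&: K -> attached S A v = attached S' A v.
Proof.
move=> vA inK SS.
have eqS b (e : edge V) : v \in val e -> val e \subset v |: A -> ((b, e) \in S) = ((b, e) \in S').
  by move=> ve eA; move/setP/(_ (b, e)): SS; rewrite !inE inK // !andbT.
by apply/idP/idP => /andP[j1 j2]; apply/andP; split; [move: j1|move: j2|move: j1|move: j2];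
  apply: joined_ext => // e ve eA; rewrite eqS.
Qed.

Lemma setUD B W : B \subset W -> B :|: W :\: B = W.
Proof.
move=> BW; apply/setP => v; rewrite !inE.
by case: (boolP (v \in B)) => // /(subsetP BW) ->.
Qed.

Lemma disjoint_setD B W : [disjoint B & W :\: B].
Proof. by rewrite disjoints_subset; apply/subsetP => v vB; rewrite !inE vB. Qed.

(** Locality is the reason for which the edges inside the reserve stay
    independent of the choice of the next layer. *)
Lemma search_local t S S' A W : [disjoint A & W] ->
  S :&: inside (A :|: W) = S' :&: inside (A :|: W) ->
  search t S A W -> search t S' A W.
Proof.
move=> + + h; elim: h => {A W} [A W tA|A W B BW aB _ IH|A W s sW _ IH] AW SS.
- exact: search_done.
- apply: (search_grow BW) => [v vB|].
    rewrite -(@attached_ext S S' v A (inside (A :|: W))) ?aB //.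
      by rewrite (disjointFl AW) // (subsetP BW).
    move=> b e ve eA; rewrite inE (subset_trans eA) // subUset sub1set subsetUl andbT.
    by rewrite inE (subsetP BW) ?orbT.
  apply: IH; first exact: disjoint_setD.
  rewrite setUD //.
  have sub : inside W \subset inside (A :|: W).
    by apply/subsetP => i; rewrite !inE => /subset_trans; apply; exact: subsetUr.
  by rewrite -(setIidPr sub) !setIA SS.
apply: (search_restart _ sW); apply: IH.
  by rewrite disjoints1 !inE eqxx.
have -> : [set s] :|: W :\ s = W by rewrite setD1K.
have sub : inside W \subset inside (A :|: W).
  by apply/subsetP => i; rewrite !inE => /subset_trans; apply; exact: subsetUr.
by rewrite -(setIidPr sub) !setIA SS.
Qed.

End Coloured.

(** * Probability of one step of the search *)

Section SearchProb.
Variables (R : realFieldType) (V : finType) (p : bool -> R).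
Hypothesis p01 : forall b, 0 <= p b <= 1.
Local Notation cedge := (bool * edge V)%type.
Implicit Types (S : {set cedge}) (A B D W X Y : {set V}).

Local Notation pe := (fun i : cedge => p i.1).
Let pe01 (i : cedge) : 0 <= pe i <= 1 := p01 i.1.
Local Notation P := (pr pe).

Lemma card_star v A b : v \notin A ->
  (#|A| <= #|[set i : cedge | (i.1 == b) && [exists a in A, val i.2 == [set v; a]]]|)%N.
Proof.
move=> vA; set D := [set i | _].
pose other (i : cedge) := odflt v [pick a in A | val i.2 == [set v; a]].
apply: leq_trans (leq_imset_card other D); apply/subset_leq_card/subsetP => a aA.
have va : v != a by apply: contraNneq vA => ->.
have c2 : #|[set v; a]| == 2%N by rewrite cards2 va.
apply/imsetP; exists (b, exist _ [set v; a] c2).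
  by rewrite inE eqxx; apply/existsP; exists a; rewrite aA /=.
rewrite /other; case: pickP => [a' /= /andP[_ /eqP/setP/(_ a)]|/(_ a)].
  by rewrite !inE eqxx orbT eq_sym (negPf va) => /esym/eqP.
by rewrite aA eqxx.
Qed.

(** The edges from [v] to [A] are [#|A|] distinct independent edges. *)
Lemma pr_not_joined b v A : v \notin A ->
  P (fun S => ~~ joined (colour b S) [set v] A) <= (1 - p b) ^+ #|A|.
Proof.
move=> vA; pose D := [set i : cedge | (i.1 == b) && [exists a in A, val i.2 == [set v; a]]].
apply: le_trans (_ : P (fun S => [disjoint D & S]) <= _).
  apply: le_pr => // S; apply: contraR => /pred0Pn[[b' e]] /=.
  rewrite inE /= => /andP[/andP[/eqP -> /existsP[a /andP[aA /eqP ve]]] eS].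
  have ev : val e = [set v; a] by [].
  apply/joinedP; exists e; split; first by rewrite inE.
    by exists v; rewrite ?set11 // ev set21.
  by exists a; rewrite // ev set22.
rewrite pr_disjoint (eq_bigr (fun=> 1 - p b)); last first.
  by move=> i; rewrite inE => /andP[/eqP -> _].
rewrite prodr_const; have /andP[p0 p1] := p01 b.
by apply: ler_wiXn2l; rewrite ?card_star // ?subr_ge0 // lerBlDr lerDl.
Qed.

Lemma pr_not_attached v A : v \notin A ->
  P (fun S => ~~ attached S A v) <= (1 - p true) ^+ #|A| + (1 - p false) ^+ #|A|.
Proof.
move=> vA; apply: le_trans (lerD (pr_not_joined true vA) (pr_not_joined false vA)).
apply: le_trans (pr_orD _ _ _) => //.
by apply: le_pr => // S; rewrite negb_and.
Qed.

(** The probability of being attached to a given set of [a] other vertices. *)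
Definition hit (a : nat) : R := (1 - (1 - p true) ^+ a) * (1 - (1 - p false) ^+ a).

Lemma miss_itv b a : 0 <= (1 - p b) ^+ a <= 1.
Proof.
have /andP[p0 p1] := p01 b.
by rewrite exprn_ge0 ?exprn_ile1 //; lra.
Qed.

Lemma hit_itv a : 0 <= hit a <= 1.
Proof.
have /andP[a0 a1] := miss_itv true a; have /andP[b0 b1] := miss_itv false a.
by rewrite mulr_ge0 ?mulr_ile1 //; lra.
Qed.

Lemma pr_two_colours (Q1 Q2 : {set edge V} -> bool) :
  P (fun S => Q1 (colour true S) && Q2 (colour false S))
    = P (fun S => Q1 (colour true S)) * P (fun S => Q2 (colour false S)).
Proof.
apply: (@pr_indep _ _ _ [set i | i.1]) => S S' e; congr (_ _);
  apply/setP => x; rewrite !inE.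
  by move/setP/(_ (true, x)): e; rewrite !inE !andbT.
by move/setP/(_ (false, x)): e; rewrite !inE !andbT.
Qed.

Lemma pr_attached v A : v \notin A -> hit #|A| <= P (fun S => attached S A v).
Proof.
move=> vA; rewrite /attached.
rewrite (pr_two_colours (fun E => joined E [set v] A) (fun E => joined E [set v] A)).
apply: ler_pM; rewrite ?subr_ge0; first by have /andP[] := miss_itv true #|A|.
- by have /andP[] := miss_itv false #|A|.
- by have := pr_not_joined true vA; rewrite pr_compl //; lra.
by have := pr_not_joined false vA; rewrite pr_compl //; lra.
Qed.

Definition common S A W : {set V} := [set v in W | attached S A v].

Lemma common_local A W (K : {set cedge}) : [disjoint A & W] ->
  (forall b (e : edge V) v, v \in W -> v \in val e -> val e \subset v |: A -> (b, e) \in K) ->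
  depends_on K (fun S => common S A W).
Proof.
move=> AW inK S S' SS; apply/setP => v; rewrite !inE.
have [vW /=|//] := boolP (v \in W).
apply: (attached_ext _ _ SS); first by rewrite (disjointFl AW).
by move=> b e; apply: inK.
Qed.

(** The vertices of [W] are attached to [A] through disjoint sets of edges, so
    their number dominates a binomial variable. *)
Lemma pr_common A W k : [disjoint A & W] ->
  btail (hit #|A|) #|W| k <= P (fun S => k <= #|common S A W|)%N.
Proof.
have h01 := hit_itv #|A|; have /andP[h0 h1] := h01.
have [n] := ubnP #|W|; elim: n W k => // n IH W k Wn AW.
have [->|[w wW]] := set_0Vmem W.
  rewrite cards0; case: k => [|k] /=; last exact: pr_ge0.
  by rewrite ?btail0 -[leLHS](expect_cst pe 1); apply: le_expect.
case: k => [|k].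
  by rewrite ?btail0 -[leLHS](expect_cst pe 1); apply: le_expect.
have wA : w \notin A by rewrite (disjointFl AW).
pose W0 := W :\ w.
have AW0 : [disjoint A & W0].
  by rewrite disjoint_sym; apply: disjointWl (_ : W0 \subset W) _; rewrite ?subD1set // disjoint_sym.
have cW : #|W| = #|W0|.+1 by rewrite (cardsD1 w) wW.
have W0n : (#|W0| < n)%N by rewrite -ltnS -cW.
pose J := [set i : cedge | w \in val i.2].
have dw : depends_on J (fun S => attached S A w).
  by move=> S S'; apply: attached_ext => // b e; rewrite inE.
have d0 : depends_on (~: J) (fun S => common S A W0).
  apply: common_local => // b e v /setD1P[vw vW] ve eA; rewrite !inE /=.
  by apply/negP => /(subsetP eA); rewrite !inE eq_sym (negPf vw) (negPf wA).
have cE S : #|common S A W| = (attached S A w + #|common S A W0|)%N.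
  rewrite (cardsD1 w) inE wW; congr (_ + _)%N; apply: eq_card => v.
  by rewrite !inE andbA.
have e1 S : ((k < #|common S A W|)%N%:R : R)
    = (attached S A w)%:R * (k <= #|common S A W0|)%N%:R
      + (~~ attached S A w)%:R * (k < #|common S A W0|)%N%:R.
  by rewrite cE; case: (attached S A w); rewrite /= ?add1n ?ltnS; ring.
rewrite /pr (eq_expect _ e1) expectD.
rewrite (expect_indep pe (depends_on_comp (fun b : bool => b%:R) dw)
          (depends_on_comp (fun C : {set V} => (k <= #|C|)%N%:R) d0)).
rewrite (expect_indep pe (depends_on_comp (fun b : bool => (~~ b)%:R) dw)
          (depends_on_comp (fun C : {set V} => (k < #|C|)%N%:R) d0)).
rewrite -!/(pr _ _) pr_compl // cW btailSS.
have := IH W0 k W0n AW0; have := IH W0 k.+1 W0n AW0; have := pr_attached wA.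
have := btail_anti h01 #|W0| k; have := pr_le1 pe01 (fun S => attached S A w).
set pw := P (fun S => attached S A w); set B := btail _ _ _; set B' := btail _ _ _.
move=> pw1 BB rw i1 i2; have pw0 : 0 <= pw by apply: le_trans rw.
apply: (@le_trans _ _ (pw * B' + (1 - pw) * B)).
  by nra.
by apply: lerD; rewrite ler_wpM2l // subr_ge0.
Qed.

Definition first_of k (C : {set V}) : {set V} := [set x in take k (enum C)].

Lemma first_of_sub k (C : {set V}) : first_of k C \subset C.
Proof. by apply/subsetP => x; rewrite inE => /mem_take; rewrite mem_enum. Qed.

Lemma card_first_of k (C : {set V}) : (k <= #|C|)%N -> #|first_of k C| = k.
Proof.
move=> kC; rewrite cardsE (card_uniqP _) ?take_uniq ?enum_uniq //.
by rewrite size_takel // -cardE.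
Qed.

Definition fail t A W : R := P (fun S => ~~ `[< search t S A W >]).

Lemma search_depends t A W : [disjoint A & W] ->
  depends_on (inside (A :|: W)) (fun S => ~~ `[< search t S A W >]).
Proof.
move=> AW S S' e; congr (~~ _); apply: asbool_equiv_eq.
by split; apply: search_local.
Qed.

(** Freeze the set of the vertices of [W] attached to [A], which depends only on
    the edges that are not inside [W]. If it is large enough, continue from a
    part of it of the required size; otherwise restart. The bound is a convex
    combination of [alpha] and [beta], and [alpha <= beta] allows replacing the
    probability of a large set by its lower bound. *)
Lemma fail_step t A W N (alpha beta : R) :
  [disjoint A & W] -> (N <= #|W|)%N ->
  (forall B, B \subset W -> #|B| = #|A|.*2 -> fail t B (W :\: B) <= alpha) ->
  alpha <= beta ->
  1 <= beta \/ (exists2 s, s \in W & fail t [set s] (W :\ s) <= beta) ->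
  fail t A W <= btail (hit #|A|) N #|A|.*2 * alpha
                + (1 - btail (hit #|A|) N #|A|.*2) * beta.
Proof.
move=> AW NW growB ab restart.
pose k := #|A|.*2.
(* [Z] is the event that the restart fails, or the sure event if there is none. *)
have [Z [dZ Zfail Zb]] : exists Z : {set cedge} -> bool,
    [/\ depends_on (inside W) Z,
        forall S, ~~ `[< search t S A W >] -> Z S & P Z <= beta].
  case: restart => [b1|[s sW sb]].
    exists xpredT; split=> //; apply: le_trans b1; exact: pr_le1.
  exists (fun S => ~~ `[< search t S [set s] (W :\ s) >]); split=> //.
    have := @search_depends t [set s] (W :\ s); rewrite setD1K //; apply.
    exact: disjoint_setD.
  move=> S; apply: contra => /asboolP h; apply/asboolP; exact: search_restart h.
pose big (C : {set V}) := (k <= #|C :&: W|)%N.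
pose B C := first_of k (C :&: W).
have BW C : B C \subset W by rewrite (subset_trans (first_of_sub _ _)) // subsetIr.
pose g C S : R := (if big C then ~~ `[< search t S (B C) (W :\: B C) >] else Z S)%:R.
pose b (C : {set V}) : R := if big C then alpha else beta.
apply: (@le_trans _ _ (expect pe (fun S => b (common S A W)))).
  apply: le_trans (@expect_freeze _ _ _ pe01 _ (~: inside W)
     (fun S => common S A W) g b _ _ _).
  - apply: le_expect => // S; rewrite /g ler_nat.
    have cI : common S A W :&: W = common S A W.
      by apply/setIidPl/subsetP => v; rewrite inE => /andP[].
    case: ifP => [_|_]; last by move: (Zfail S); case: (~~ _) => // /(_ isT) ->.
    suff : `[< search t S (B (common S A W)) (W :\: B (common S A W)) >] ->
           `[< search t S A W >] by case: (asbool (search t S A W)) => //; case: asbool => // /(_ isT).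
    move=> /asboolP h; apply/asboolP; apply: search_grow h => // v vB.
    have := subsetP (first_of_sub k (common S A W :&: W)) v vB.
    by rewrite cI inE => /andP[].
  - apply: common_local => // b' e v vW ve eA; rewrite !inE /=.
    apply/negP => eW; have : val e \subset [set v].
      apply/subsetP => x xe; move: (subsetP eA x xe); rewrite !inE.
      by case: eqP => // _ /(disjointFr AW); rewrite (subsetP eW).
    by move/subset_leq_card; rewrite cards1 (eqP (valP e)).
  - move=> C; rewrite setCK /g => S S' e; congr (nat_of_bool _)%:R.
    case: ifP => _; last exact: dZ.
    apply: (@search_depends t (B C)); first exact: disjoint_setD.
    by rewrite setUD.
  - move=> C; rewrite /g /b; case: ifP => bigC; last exact: Zb.
    by apply: growB; rewrite ?BW // card_first_of.
have -> : expect pe (fun S => b (common S A W))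
   = beta + (alpha - beta) * P (fun S => k <= #|common S A W|)%N.
  rewrite -expectZl -[X in _ = X + _](expect_cst pe) -expectD; apply: eq_expect => S.
  have cI : common S A W :&: W = common S A W.
    by apply/setIidPl/subsetP => v; rewrite inE => /andP[].
  by rewrite /b /big cI; case: ifP => _ /=; ring.
have := pr_common k AW; have := btail_mono (hit_itv #|A|) k NW.
rewrite -/k; set T := btail _ N k; set T' := btail _ _ _; set Pk := P _ => h1 h2.
by nra.
Qed.

End SearchProb.

(** * Growth through all levels *)

Section Growth.
Variables (R : realFieldType) (V : finType) (p : bool -> R).
Hypothesis p01 : forall b, 0 <= p b <= 1.
Local Notation cedge := (bool * edge V)%type.
Implicit Types (S : {set cedge}) (A B D W X Y : {set V}).

Local Notation pe := (fun i : cedge => p i.1).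
Let pe01 (i : cedge) : 0 <= pe i <= 1 := p01 i.1.
Local Notation P := (pr pe).
Local Notation level_tail N j := (btail (hit p (2 ^ j)) N (2 ^ j.+1)).

Lemma card_setD_sub B W : B \subset W -> #|W :\: B| = (#|W| - #|B|)%N.
Proof. by move=> BW; rewrite cardsD (setIidPr BW). Qed.

Lemma fail_le1 t A W : fail p t A W <= 1.
Proof. exact: pr_le1. Qed.

(** Above the seed level a failure is given up, so the failure probabilities of
    the levels add up. The layers from [j.+1] to [J] use up
    2 ^ (J + 1) - 2 ^ (j + 1) vertices, which the hypothesis on [W] provides. *)
Lemma fail_late t N (err : nat -> R) J : (t <= 2 ^ J)%N ->
  (forall i, 0 <= err i) ->
  forall d j A W, (j + d = J)%N -> [disjoint A & W] -> #|A| = (2 ^ j)%N ->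
  (N + 2 ^ J.+1 <= #|W| + 2 ^ j.+1)%N ->
  (forall i, (j <= i < J)%N -> 1 - level_tail N i <= err i) ->
  fail p t A W <= \sum_(j <= i < J) err i.
Proof.
move=> tJ e0; elim=> [|d IH] j A W jd AW cA cW tail.
  rewrite big_geq; last by rewrite -jd addn0.
  rewrite /fail (_ : pr _ _ = P (fun=> false)).
    by rewrite /pr expect_cst.
  apply: eq_expect => S; case: asboolP => // -[]; apply: search_done.
  by rewrite cA -(addn0 j) jd.
have jJ : (j < J)%N by rewrite -jd addnS ltnS leq_addr.
have cA2 : #|A|.*2 = (2 ^ j.+1)%N by rewrite cA expnS mul2n.
have pow : (2 ^ j.+2 <= 2 ^ J.+1)%N by rewrite leq_exp2l.
rewrite big_ltn //; set s := \sum_(_ <= i < J) err i.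
have s0 : 0 <= s by apply: sumr_ge0.
have [s1|s1] := leP 1 s.
  apply: le_trans (fail_le1 _ _ _) (le_trans s1 _).
  by rewrite lerDr.
have NW : (N <= #|W|)%N by move: pow cW; rewrite (expnS 2 j.+1); lia.
apply: (le_trans (@fail_step _ _ _ p01 t A W N s 1 AW NW _ (ltW s1) _)); last first.
- have := tail j; rewrite leqnn jJ => /(_ isT).
  rewrite cA2 cA; have /andP[] := btail_itv (hit_itv p01 (2 ^ j)) N (2 ^ j.+1).
  set T := btail _ _ _ => *; nra.
- by left.
move=> B BW cB; apply: IH.
- by rewrite addSnnS.
- exact: disjoint_setD.
- by rewrite cB cA2.
- rewrite card_setD_sub // cB cA2; have := subset_leq_card BW; rewrite cB cA2.
  by move: cW; rewrite (expnS 2 j.+1); lia.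
by move=> i /andP[ji iJ]; apply: tail; rewrite iJ ltnW.
Qed.

(** [Q j] is a lower bound for the probability of going from level [j] up to
    level [I] without a failure. With [m] restarts left at level [j], all
    attempts fail with probability at most (1 - Q j) (1 - Q 0) ^ m, up to the
    error [delta] of the later levels; one step preserves this bound as soon as
    Q j is at most the product of the probability of level j and Q (j + 1).
    Each attempt uses at most 2 ^ (I + 1) vertices. *)
Lemma fail_early t N N' I (Q : nat -> R) (delta : R) : (N <= N')%N -> 0 <= delta ->
  (forall j, 0 <= Q j <= 1) -> Q I = 1 ->
  (forall j, (j < I)%N -> Q j <= level_tail N j * Q j.+1) ->
  (forall A W, [disjoint A & W] -> #|A| = (2 ^ I)%N -> (N' <= #|W|)%N ->
     fail p t A W <= delta) ->
  forall m d j A W, (j + d = I)%N -> [disjoint A & W] -> #|A| = (2 ^ j)%N ->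
  (N' + m.+1 * 2 ^ I.+1 <= #|W| + 2 ^ j.+1)%N ->
  fail p t A W <= delta + (1 - Q j) * (1 - Q 0%N) ^+ m.
Proof.
move=> NN' d0 Q01 QI Qstep late; elim=> [|m IHm]; elim=> [|d IHd] j A W jd AW cA cW.
- rewrite addn0 in jd; rewrite jd QI subrr mul0r addr0; apply: late => //.
    by rewrite cA jd.
  by move: cW; rewrite jd; lia.
- have jI : (j < I)%N by rewrite -jd addnS ltnS leq_addr.
  have cA2 : #|A|.*2 = (2 ^ j.+1)%N by rewrite cA expnS mul2n.
  have pow : (2 ^ j.+2 <= 2 ^ I.+1)%N by rewrite leq_exp2l.
  have NW : (N <= #|W|)%N by move: pow cW; rewrite (expnS 2 j.+1); lia.
  have /andP[Q0 Q1] := Q01 j.+1.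
  apply: (le_trans (@fail_step _ _ _ p01 t A W N (delta + (1 - Q j.+1)) (delta + 1) AW NW _ _ _)).
  + move=> B BW cB; rewrite -[X in delta + X]mulr1 -(expr0 (1 - Q 0%N)); apply: IHd.
    * by rewrite addSnnS.
    * exact: disjoint_setD.
    * by rewrite cB cA2.
    * rewrite card_setD_sub // cB cA2; have := subset_leq_card BW; rewrite cB cA2.
      by move: cW; rewrite (expnS 2 j.+1); lia.
  + lra.
  + by left; rewrite lerDr.
  rewrite cA2 cA expr0 mulr1; have := Qstep j jI; set T := btail _ _ _; nra.
- rewrite addn0 in jd; rewrite jd QI subrr mul0r addr0; apply: late => //.
    by rewrite cA jd.
  by move: cW; rewrite jd; lia.
have jI : (j < I)%N by rewrite -jd addnS ltnS leq_addr.
have cA2 : #|A|.*2 = (2 ^ j.+1)%N by rewrite cA expnS mul2n.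
have pow : (2 ^ j.+2 <= 2 ^ I.+1)%N by rewrite leq_exp2l.
have NW : (N <= #|W|)%N by move: pow cW; rewrite (expnS 2 j.+1) mulSn; lia.
have /andP[Q0 Q1] := Q01 j.+1; have /andP[Q00 Q01'] := Q01 0%N.
set x := (1 - Q 0%N) ^+ m.+1.
have x0 : 0 <= x by apply: exprn_ge0; lra.
have two : (2 ^ 1 <= 2 ^ j.+1)%N by rewrite leq_exp2l.
apply: (le_trans (@fail_step _ _ _ p01 t A W N (delta + (1 - Q j.+1) * x) (delta + x) AW NW _ _ _)).
- move=> B BW cB; apply: IHd.
  + by rewrite addSnnS.
  + exact: disjoint_setD.
  + by rewrite cB cA2.
  rewrite card_setD_sub // cB cA2; have := subset_leq_card BW; rewrite cB cA2.
  by move: cW; rewrite (expnS 2 j.+1); lia.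
- nra.
- right; have [s sW] : exists s, s \in W.
    by apply/card_gt0P; move: cW pow two; rewrite (expnS 2 j.+1) mulSn; lia.
  exists s => //; rewrite /x exprS; apply: (IHm I 0%N) => //.
  + exact: disjoint_setD.
  + by rewrite cards1.
  have := cardsD1 s W; rewrite sW; move: cW pow two.
  by rewrite (expnS 2 j.+1) (mulSn m.+1) expn1; lia.
rewrite cA2 cA; have := Qstep j jI; set T := btail _ _ _; nra.
Qed.

(** The cluster found inside [Y] must be a function of the edges inside [Y]
    alone before the edges leaving [Y] are used, so it is selected by means of
    the restriction of the edge set to [Y]. *)
Lemma not_percolates_le t v0 Y : v0 \in Y ->
  P (fun S => ~~ `[< percolates (two_colours S) >]) <=
    fail p t [set v0] (Y :\ v0)
    + (#|~: Y|%:R * ((1 - p true) ^+ t + (1 - p false) ^+ t)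
    + #|Y|%:R * ((1 - p true) ^+ #|~: Y| + (1 - p false) ^+ #|~: Y|)).
Proof.
move=> vY.
have V0 : (0 < #|V|)%N by apply/card_gt0P; exists v0.
pose K : {set cedge} := inside Y.
pose good X S := [&& X \subset Y, (t <= #|X|)%N & `[< clumped S X >]].
pose sel S := [pick X | good X (S :&: K)].
(* The size condition is built into [h], as freezing asks for a bound at every
   value of the selected set. *)
pose h (o : option {set V}) S : bool :=
  if o is Some X then [&& X \subset Y, (t <= #|X|)%N & [exists v in ~: Y, ~~ attached S X v]]
  else false.
pose bad S := [exists v in Y, ~~ attached S (~: Y) v].
apply: (@le_trans _ _ (P (fun S => (~~ `[< search t S [set v0] (Y :\ v0) >])
                                     || (h (sel S) S || bad S)))).
  apply: le_pr => // S; apply: contraR; rewrite !negb_or negbK => /and3P[/asboolP se nh nb].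
  have loc : search t (S :&: K) [set v0] (Y :\ v0).
    apply: search_local se; first exact: disjoint_setD.
    by rewrite setD1K // -setIA setIid.
  have [X0 [X0Y tX0 cX0]] := search_clumped loc (@clumped1 _ _ v0).
  rewrite setD1K // in X0Y.
  move: nh; rewrite /h /sel; case: pickP => [X /and3P[XY tX /asboolP cX]|]; last first.
    by move/(_ X0); rewrite /good X0Y tX0 /=; case: asboolP.
  rewrite XY tX /= negb_exists_in => /forall_inP aX.
  apply/asboolP; apply: (@clumped_percolates _ S X Y V0).
  - exact: clumped_sub (subsetIl _ _) cX.
  - by move=> v vY'; move: (aX v vY'); rewrite negbK.
  by move: nb; rewrite negb_exists_in => /forall_inP nb v /nb; rewrite negbK.
apply: (le_trans (pr_orD pe01 _ _)); apply: lerD => //.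
apply: (le_trans (pr_orD pe01 _ _)); apply: lerD; last first.
  apply: (le_trans (pr_union pe01 _ _)).
  rewrite -[X in X%:R * _]sum1_card natr_sum mulr_suml.
  apply: ler_sum => v vY'; rewrite mul1r; apply: pr_not_attached => //.
  by rewrite inE negbK.
have dsel : depends_on K sel.
  by move=> S S' e; rewrite /sel e.
have dh o : depends_on (~: K) (h o).
  move=> S S' e; case: o => [X|//] /=.
  case XY: (X \subset Y) => //=; case: (t <= #|X|)%N => //=.
  apply: eq_existsb => v; case vY': (v \in ~: Y) => //=; congr (~~ _).
  apply: (@attached_ext _ S S' v X (~: K)) => //.
    by rewrite inE in vY'; apply: contra vY' => /(subsetP XY).
  move=> b ed ve _; rewrite !inE /=; apply/negP => /subsetP/(_ v ve).
  by rewrite inE in vY'; rewrite (negPf vY').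
set c := (X in _ <= X).
have p0 b : 0 <= 1 - p b by case/andP: (p01 b) => *; lra.
have c0 : 0 <= c by rewrite mulr_ge0 // addr_ge0 // exprn_ge0.
rewrite -[leRHS](expect_cst pe).
apply: (@expect_freeze _ _ _ pe01 _ K sel (fun o S => (h o S)%:R) (fun=> c) dsel); [move=> o|move=> o].
  by apply: (depends_on_comp (fun b : bool => b%:R)); exact: dh.
case: o => [X|] /=; last by rewrite expect_cst.
have [/andP[XY tX]|nX] := boolP ((X \subset Y) && (t <= #|X|)%N); last first.
  rewrite (eq_expect _ (_ : _ =1 fun=> 0)) ?expect_cst // => S.
  by rewrite andbA (negPf nX).
rewrite XY tX /=; apply: (le_trans (pr_union pe01 _ _)).
rewrite /c -[X in X%:R * _]sum1_card natr_sum mulr_suml.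
apply: ler_sum => v; rewrite inE => vY'; rewrite mul1r.
apply: le_trans (pr_not_attached p01 (_ : v \notin X)) _.
  by apply: contra vY' => /(subsetP XY).
by apply: lerD; apply: ler_wiXn2l => //; have := p0 true; have := p0 false; have := p01 true; have := p01 false; lra.
Qed.

End Growth.

(** * The subcritical bound *)

(** Since k ^ k is at most (2k) falling k = C(2k, k) k!, which is at most
    4 ^ k k!. *)
Lemma bin_expn_le n k : ('C(n, k) * k ^ k <= (4 * n) ^ k)%N.
Proof.
have kk : (k ^ k <= 4 ^ k * k`!)%N.
  have ffact_ge m : (k ^ m <= (k + m) ^_ m)%N.
    elim: m => [|m IH]; first by rewrite ffactn0.
    by rewrite addnS ffactSS expnS leq_mul // -addnS leq_addr.
  apply: leq_trans (ffact_ge k) _; rewrite -bin_ffact leq_mul2r; apply/orP; right.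
  rewrite addnn (_ : 4 ^ k = 2 ^ k.*2)%N; last by rewrite -mul2n expnM.
  have := Pascal 1 1 k.*2; rewrite /= addn1 => ->.
  have kin : (k < k.*2.+1)%N by rewrite ltnS -addnn leq_addr.
  by rewrite (bigD1 (Ordinal kin)) //= !exp1n !muln1 leq_addr.
rewrite expnMn; apply: leq_trans (leq_mul (leqnn _) kk) _.
rewrite mulnCA leq_mul2l; apply/orP; right; rewrite bin_ffact.
elim: k n {kk} => [|k IH] n; first by rewrite ffactn0.
case: n => [|n]; first by rewrite ffact0n.
rewrite ffactSS expnS leq_mul //; apply: leq_trans (IH n) _.
by case: k {IH} => // k; rewrite leq_exp2r.
Qed.

Section Subcritical.
Variables (R : realFieldType) (V : finType) (p : bool -> R).
Hypothesis p01 : forall b, 0 <= p b <= 1.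
Local Notation cedge := (bool * edge V)%type.
Local Notation pe := (fun i : cedge => p i.1).
Let pe01 (i : cedge) : 0 <= pe i <= 1 := p01 i.1.
Local Notation P := (pr pe).

(** Union bound over the parent functions on [X :\ r]: there are at most
    k ^ (k - 1) of them, and each needs k - 1 distinct edges. *)
Lemma pr_cut_connected b (X : {set V}) : X != set0 ->
  P (fun S => cut_connected (colour b S) X) <= (#|X|%:R * p b) ^+ #|X|.-1.
Proof.
case/set0Pn=> r rX.
have cX : #|X :\ r| = #|X|.-1 by rewrite (cardsD1 r X) rX.
pose F := [set f in pffun_on r (mem (X :\ r)) (mem X) | #|parent_edges f (X :\ r)| == #|X|.-1].
pose D (f : {ffun V -> V}) : {set cedge} := [set (b, e) | e in parent_edges f (X :\ r)].
have /andP[p0 p1] := p01 b.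
apply: (@le_trans _ _ (P (fun S => [exists f in F, D f \subset S]))).
  apply: le_pr => // S /(cut_connected_parent rX)[f [fX cf fS]].
  apply/exists_inP; exists f; first by rewrite inE fX cf eqxx.
  by apply/subsetP => _ /imsetP[e /(subsetP fS) eS ->]; rewrite inE in eS.
apply: (le_trans (pr_union pe01 _ _)).
rewrite (eq_bigr (fun=> p b ^+ #|X|.-1)) => [|f].
  rewrite sumr_const -[leLHS]mulr_natl exprMn ler_wpM2r ?exprn_ge0 //.
  rewrite -natrX ler_nat -cX.
  apply: leq_trans (_ : #|pffun_on r (mem (X :\ r)) (mem X)| <= _)%N.
    by apply/subset_leq_card/subsetP => f; rewrite inE => /andP[].
  by rewrite card_pffun_on.
rewrite inE => /andP[_ /eqP cf]; rewrite pr_superset.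
rewrite (eq_bigr (fun=> p b)); last by move=> _ /imsetP[e _ ->].
by rewrite prodr_const card_imset ?cf // => e e' [].
Qed.

Lemma pr_doubly_connected (X : {set V}) : X != set0 ->
  P (fun S => @doubly_connected (two_colours S) X)
    <= (#|X|%:R ^+ 2 * (p true * p false)) ^+ #|X|.-1.
Proof.
move=> X0; rewrite -[leLHS]/(P (fun S =>
  cut_connected (colour true S) X && cut_connected (colour false S) X)).
rewrite (pr_two_colours p (fun E => cut_connected E X) (fun E => cut_connected E X)).
rewrite (_ : #|X|%:R ^+ 2 * (p true * p false) = #|X|%:R * p true * (#|X|%:R * p false)); last by ring.
rewrite [leRHS]exprMn; apply: ler_pM; rewrite ?pr_ge0 //; exact: pr_cut_connected.
Qed.

(** The sets of size k contribute at most 4 n (4 n k p1 p2) ^ (k - 1) to the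
    union bound, where k < 2 L, and there are [L] sizes. *)
Lemma pr_percolates_le L : (1 < L)%N -> (L <= #|V|)%N ->
  8 * L%:R * #|V|%:R * (p true * p false) <= 1 / 16 ->
  P (fun S => `[< percolates (two_colours S) >])
    <= L%:R * (4 * #|V|%:R / 16 ^+ L.-1).
Proof.
move=> L1 LV small.
have /andP[p10 p11] := p01 true; have /andP[p20 p21] := p01 false.
set s := p true * p false in small; have s0 : 0 <= s by rewrite mulr_ge0.
pose rng := [set X : {set V} | (L <= #|X|)%N && (#|X| < L.*2)%N].
apply: (@le_trans _ _ (P (fun S => [exists X in rng, @doubly_connected (two_colours S) X]))).
  apply: le_pr => // S /asboolP perc.
  have [X [dX LX XL]] := @percolates_doubly_connected (two_colours S) L L1 LV perc.
  by apply/exists_inP; exists X; rewrite // inE LX XL.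
apply: (le_trans (pr_union pe01 _ _)).
pose F k : R := (k%:R ^+ 2 * s) ^+ k.-1.
apply: (@le_trans _ _ (\sum_(X in rng) F #|X|)).
  apply: ler_sum => X; rewrite inE => /andP[LX _]; apply: pr_doubly_connected.
  by rewrite -card_gt0 (leq_trans _ LX) // ltnW.
have term k : (L <= k < L.*2)%N ->
    'C(#|V|, k)%:R * F k <= 4 * #|V|%:R / 16 ^+ L.-1.
  move=> /andP[Lk kL]; have k0 : (0 < k)%N by apply: leq_trans Lk; apply: ltnW.
  have small_k : 0 <= 4 * #|V|%:R * (k%:R * s) <= 1 / 16.
    rewrite !mulr_ge0 //=; apply: le_trans small.
    have kL' : k%:R <= 2 * L%:R :> R by rewrite -natrM ler_nat mul2n ltnW.
    have : 0 <= 4 * #|V|%:R * s by rewrite !mulr_ge0.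
    by nra.
  have bk : 'C(#|V|, k)%:R * k%:R ^+ k <= (4 * #|V|%:R) ^+ k :> R.
    by rewrite -[4]/(4%:R) -natrX -!natrM -natrX ler_nat bin_expn_le.
  apply: (@le_trans _ _ ((4 * #|V|%:R) ^+ k * (k%:R * s) ^+ k.-1)).
    apply: (@le_trans _ _ ('C(#|V|, k)%:R * k%:R ^+ k * (k%:R * s) ^+ k.-1)).
      rewrite /F -mulrA ler_wpM2l // expr2 -mulrA exprMn ler_wpM2r //.
        by rewrite exprn_ge0 // mulr_ge0.
      by apply: ler_weXn2l; rewrite ?leq_pred // ler1n.
    by rewrite ler_wpM2r // exprn_ge0 // mulr_ge0.
  rewrite -{1}(prednK k0) exprS -mulrA -exprMn ler_wpM2l //.
  apply: (@le_trans _ _ ((1 / 16) ^+ k.-1)).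
    by case/andP: small_k => h0 h1; apply: lerXn2r; rewrite ?nnegrE.
  rewrite div1r exprVn lef_pV2 ?posrE ?exprn_gt0 //.
  by apply: ler_weXn2l; [rewrite ler1n|lia].
case: L L1 @rng term {LV small} => [//|L'] _ rng term.
rewrite (partition_big (fun X : {set V} => inord (#|X| - L'.+1) : 'I_L'.+1) predT) //=.
rewrite -[X in X%:R * _](card_ord L'.+1) mulr_natl -sumr_const.
apply: ler_sum => k _.
apply: le_trans (term (L'.+1 + k)%N _); last first.
  by rewrite leq_addr /= -addnn ltn_add2l ltn_ord.
rewrite -card_draws mulr_natl -sumr_const.
rewrite big_mkcond [leRHS]big_mkcond; apply: ler_sum => X _ /=.
rewrite !inE; case: ifP => [/andP[/andP[LX XL] /eqP kX]|_].
  have -> : #|X| = (L'.+1 + k)%N.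
    rewrite -kX inordK ?subnKC //; move: XL LX; rewrite -addnn; lia.
  by rewrite eqxx.
by case: ifP => // _; rewrite exprn_ge0 // mulr_ge0 ?sqr_ge0.
Qed.

End Subcritical.

(** * The supercritical bound *)

Lemma miss_pow2 (R : realType) (x : R) m k : 0 <= x <= 1 ->
  k%:R <= m%:R * x -> (1 - x) ^+ m <= (1 / 2) ^+ k.
Proof.
move=> /andP[x0 x1] kmx.
apply: (@le_trans _ _ (expR (- x) ^+ m)).
  by apply: lerXn2r; rewrite ?nnegrE ?expR_ge0 ?subr_ge0 // expR_ge1Dx.
apply: (@le_trans _ _ (expR (- 1) ^+ k)).
  by rewrite -!expRM_natl ler_expR; lra.
apply: lerXn2r; rewrite ?nnegrE ?expR_ge0 ?divr_ge0 //.
rewrite expRN div1r lef_pV2 ?posrE ?expR_gt0 //.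
by have := expR_ge1Dx (1 : R); lra.
Qed.

(** The sum is the base 2 logarithm of the inverse of the lower bound for the
    probability that the first [I] levels all succeed; its order is 2 ^ I without a factor [I]
    because the last levels, which dominate it, have bounded weights. *)
Lemma weighted_powers_le I :
  (\sum_(0 <= i < I) (I - i).+1 * 2 ^ i.+1 + (I.*2 + 6) <= 6 * 2 ^ I)%N.
Proof.
elim: I => [|I IH]; first by rewrite big_geq.
rewrite big_nat_recl //= subn0 expn1.
rewrite (eq_bigr (fun i => 2 * ((I - i).+1 * 2 ^ i.+1))%N) => [|i _].
  rewrite -big_distrr /=; move: IH; set s := (\sum_(_ <= _ < _) _)%N.
  by rewrite (expnS 2 I); lia.
by rewrite subSS mulnCA -expnS.
Qed.

(** Chosen with 2 ^ (seed_level l) between l / 48 and l / 24: large enough for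
    the later levels to be typical, and small enough for an attempt to succeed
    with probability at least 2 ^ (- l / 4). *)
Definition seed_level l := trunc_log 2 (l %/ 24).

Lemma seed_level_le l : (24 <= l)%N -> (24 * 2 ^ seed_level l <= l)%N.
Proof.
move=> l24; have := @trunc_logP 2 (l %/ 24) isT; rewrite divn_gt0 // => /(_ l24).
by rewrite -/(seed_level l); have := leq_trunc_div l 24; lia.
Qed.

Lemma seed_level_ge l : (l <= 48 * 2 ^ seed_level l)%N.
Proof.
have := @trunc_log_ltn 2 (l %/ 24) isT; rewrite -/(seed_level l) expnS.
by have := ltn_ceil l (isT : 0 < 24)%N; lia.
Qed.

Lemma seed_level_small l : (24 <= l)%N -> (24 * (seed_level l).+1 <= l)%N.
Proof.
move=> l24; apply: leq_trans (seed_level_le l24).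
by rewrite leq_mul2l /= ltn_expl.
Qed.

(** The vertex budget: half of the vertices suffice for all the restarts, for
    the later levels, and for a reserve that always keeps 2 ^ (l - 2)
    vertices. *)
Lemma reserve_large l (I := seed_level l) : (24 <= l)%N ->
  (2 ^ (l - 2) + 2 ^ (l - 8).+1 + (2 ^ (l %/ 2)).+1 * 2 ^ I.+1 <= 2 ^ (l - 1) + 1)%N.
Proof.
move=> l24; have Il := seed_level_small l24; rewrite -/I in Il.
have hl := leq_trunc_div l 2.
have -> : (l - 1 = 4 + (l - 5))%N by lia.
have -> : (l - 2 = 3 + (l - 5))%N by lia.
have e1 : (2 ^ (l - 8).+1 <= 2 ^ (l - 5))%N by rewrite leq_exp2l //; lia.
have e2 : ((2 ^ (l %/ 2)).+1 * 2 ^ I.+1 <= 2 ^ (l - 5))%N.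
  apply: (@leq_trans (2 ^ (l %/ 2).+1 * 2 ^ I.+1)%N).
    by rewrite leq_mul2r ltn_exp2l // ltnSn orbT.
  by rewrite -expnD leq_exp2l //; lia.
by rewrite !(expnD 2 _ (l - 5)) (_ : 2 ^ 4 = 16)%N // (_ : 2 ^ 3 = 8)%N //; lia.
Qed.

Lemma sum_halves (R : realFieldType) I J : (I <= J)%N ->
  \sum_(I <= i < J) (1 / 2 : R) ^+ i.+1 <= (1 / 2) ^+ I.
Proof.
move=> IJ; suff : \sum_(I <= i < J) (1 / 2 : R) ^+ i.+1 + (1 / 2) ^+ J = (1 / 2) ^+ I.
  by move=> <-; rewrite lerDl exprn_ge0 // divr_ge0.
elim: J IJ => [|J IH] IJ.
  by rewrite big_geq //; move: IJ; rewrite leqn0 => /eqP ->; rewrite add0r.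
move: IJ; rewrite leq_eqVlt => /orP[/eqP->|IJ]; first by rewrite big_geq ?add0r.
rewrite big_nat_recr //= -(IH IJ) -addrA; congr (_ + _).
by rewrite exprS; set x := _ ^+ J; field.
Qed.

Section Supercritical.
Variables (R : realType) (V : finType) (p : bool -> R) (l : nat).
Hypothesis p01 : forall b, 0 <= p b <= 1.
Hypothesis l24 : (24 <= l)%N.
Hypothesis nl : (2 ^ l <= #|V| < 2 ^ l.+1)%N.
Hypothesis p_big : forall b, 512 * l%:R <= 2 ^+ l * p b.
Hypothesis pp_big : 128 * 48 <= l%:R * (2 ^+ l * (p true * p false)).

Local Notation I := (seed_level l).
Local Notation J := (l - 8)%N.
Local Notation N := (2 ^ (l - 2))%N.
Local Notation h := (l %/ 2)%N.

Let l0 : 0 < l%:R :> R.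
Proof. by rewrite ltr0n (leq_trans _ l24). Qed.

Let pow_split a b : (a <= b)%N -> (2 : R) ^+ b = 2 ^+ a * 2 ^+ (b - a).
Proof. by move=> ab; rewrite -exprD subnKC. Qed.

(** Each vertex of the reserve is attached to the layer with probability at
    least r, where N r is at least 8 * 2 ^ j, four times the required size
    2 ^ (j + 1). *)
Lemma late_level j : (I <= j < J)%N ->
  1 - btail (hit p (2 ^ j)) N (2 ^ j.+1) <= (1 / 2) ^+ j.+1.
Proof.
move=> /andP[Ij jJ]; set r := hit _ _.
have r01 : 0 <= r <= 1 := hit_itv p01 _.
set b : R := 2 ^+ j.
have b1 : 1 <= b by rewrite exprn_ege1 // ler1n.
have bI : 2 ^+ I <= b by rewrite ler_weXn2l // ler1n.
have NE : N%:R = 2 ^+ (l - 2) :> R by rewrite natrX.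
have lE : 2 ^+ l = 4 * 2 ^+ (l - 2) :> R.
  by rewrite (@pow_split 2 l) ?(leq_trans _ l24) //; congr (_ * _); lra.
have jl : (7 + j <= l - 2)%N by move: jJ; clear; lia.
have bN : 128 * b <= N%:R.
  rewrite NE (@pow_split (7 + j)) //.
  rewrite exprD -[X in X <= _]mulr1 ler_pM //; rewrite ?exprn_ege1 ?ler1n //.
    by rewrite mulr_ge0 // (le_trans _ b1).
  by rewrite ler_wpM2r ?(le_trans _ b1) //; lra.
have lb : l%:R <= 48 * b.
  apply: (@le_trans _ _ (48 * 2 ^+ I)); last by rewrite ler_wpM2l.
  by rewrite -natrX -natrM ler_nat seed_level_ge.
have l24' : (24 : R) <= l%:R by rewrite ler_nat.
have scale q : 32 <= q -> 4 * (8 * b) <= b * q.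
  move=> q32; rewrite (_ : 4 * (8 * b) = b * 32); last by ring.
  by rewrite ler_wpM2l // (le_trans _ b1).
have Nr : 8 * b <= N%:R * r.
  apply: hit_hit_ge => //; rewrite ?natrX -/b.
  - lra.
  - rewrite [leRHS]mulrCA; apply: scale => //; have := p_big true; rewrite lE -NE -mulrA.
    by set q := N%:R * _; lra.
  - rewrite [leRHS]mulrCA; apply: scale => //; have := p_big false; rewrite lE -NE -mulrA.
    by set q := N%:R * _; lra.
  move: pp_big; rewrite lE -NE; set s := p true * p false => pb.
  rewrite [leRHS](_ : _ = b * (b * (N%:R * s))); last by rewrite /s; ring.
  apply: scale => //.
  have s0 : 0 <= N%:R * s.
    by rewrite !mulr_ge0 //; [have /andP[] := p01 true|have /andP[] := p01 false].
  rewrite -mulrA in pb; have := ler_wpM2r s0 lb; lra.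
have := btail_chernoff r01 N (2 ^ j.+1).
suff : 2 ^+ (2 ^ j.+1) * (1 - r / 2) ^+ N <= (1 / 2) ^+ j.+1 by lra.
have r2 : 0 <= r / 2 <= 1 by lra.
have : (1 - r / 2) ^+ N <= (1 / 2) ^+ (2 ^ j.+2).
  apply: miss_pow2 => //; rewrite natrX !exprS -/b; lra.
have b0 : 0 <= 2 ^+ (2 ^ j.+1) :> R by rewrite exprn_ge0.
move=> /(ler_wpM2l b0) /le_trans; apply.
rewrite (expnS 2 j.+1) mul2n -addnn exprD mulrA -exprMn mulrC.
rewrite (_ : 2 * (1 / 2) = 1 :> R); last by lra.
rewrite expr1n mulr1; apply: ler_wiXn2l; rewrite ?divr_ge0 //; first lra.
by apply: ltnW; rewrite ltn_expl.
Qed.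

(** The reserve is cut into 2 ^ (j + 1) blocks of [m] vertices, each of which
    has to contain an attached vertex; the expected number of those in one block
    is at least 2 ^ (j - I). *)
Lemma early_level j : (j < I)%N ->
  (1 / 2) ^+ ((I - j).+1 * 2 ^ j.+1) <= btail (hit p (2 ^ j)) N (2 ^ j.+1).
Proof.
move=> jI; set r := hit _ _; have r01 : 0 <= r <= 1 := hit_itv p01 _.
pose m := (2 ^ (l - (3 + j)))%N.
have jl : (j + 8 <= l)%N.
  by move: (seed_level_small l24) l24 jI; clear; lia.
have Nm : N = (2 ^ j.+1 * m)%N.
  by rewrite /m -expnD; congr (_ ^ _)%N; move: jl; clear; lia.
rewrite Nm; apply: le_trans (btail_power r01 m (2 ^ j.+1)).
have half0 : 0 <= 1 / 2 :> R by rewrite divr_ge0.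
rewrite exprM; apply: lerXn2r; rewrite ?nnegrE ?exprn_ge0 //.
  by rewrite subr_ge0; case/andP: r01 => *; apply: exprn_ile1; lra.
rewrite exprSr mulrA mulr1; set y : R := (1 / 2) ^+ (I - j).
have y1 : y <= 1 by apply: exprn_ile1; lra.
have y0 : 0 <= y by apply: exprn_ge0.
apply: hit_ge => //.
set b : R := 2 ^+ j.
have b1 : 1 <= b by rewrite exprn_ege1 // ler1n.
have lE : 2 ^+ l = 8 * b * m%:R :> R.
  rewrite /m natrX (@pow_split (3 + j) l); last by move: jl; clear; lia.
  by rewrite exprD; congr (_ * _ * _); lra.
have m4 : 4 <= m%:R :> R.
  rewrite /m (_ : (l - (3 + j))%N = (2 + (l - (5 + j)))%N); last by move: jl; clear; lia.
  by rewrite natrX exprD; have : 1 <= 2 ^+ (l - (5 + j)) :> R; [rewrite exprn_ege1 // ler1n|lra].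
have yb : y * 2 ^+ I = b.
  rewrite (@pow_split j I) ?(ltnW jI) // mulrCA -exprMn.
  by rewrite (_ : 1 / 2 * 2 = 1 :> R) ?expr1n ?mulr1 //; lra.
have l24' : (24 : R) <= l%:R by rewrite ler_nat.
apply: hit_hit_ge => //; rewrite ?(natrX _ 2 j) -/b.
- lra.
- have := p_big true; rewrite lE (_ : _ * p true = 8 * (m%:R * (b * p true))); last by ring.
  by set q := m%:R * _ => ?; lra.
- have := p_big false; rewrite lE (_ : _ * p false = 8 * (m%:R * (b * p false))); last by ring.
  by set q := m%:R * _ => ?; lra.
move: pp_big; rewrite lE; set s := p true * p false => pb.
rewrite [leRHS](_ : _ = b * (b * m%:R * s)); last by rewrite /s; ring.
have lI : l%:R <= 48 * 2 ^+ I :> R by rewrite -natrX -natrM ler_nat seed_level_ge.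
have s0 : 0 <= b * m%:R * s.
  rewrite !mulr_ge0 ?(le_trans _ b1) //; [by have /andP[] := p01 true|by have /andP[] := p01 false].
rewrite (_ : 8 * b * m%:R * s = 8 * (b * m%:R * s)) in pb; last by ring.
rewrite -{1}yb -mulrA [leRHS]mulrC [leLHS]mulrC; move: (b * m%:R * s) s0 pb => q q0 pb.
by have := ler_wpM2r q0 lI; nra.
Qed.

Let half_itv k : 0 <= (1 / 2 : R) ^+ k <= 1.
Proof. by rewrite exprn_ge0 ?exprn_ile1 //; lra. Qed.

Lemma fail_late_le (A W : {set V}) : [disjoint A & W] -> #|A| = (2 ^ I)%N ->
  (N + 2 ^ J.+1 <= #|W|)%N -> fail p (2 ^ J) A W <= (1 / 2) ^+ I.
Proof.
move=> AW cA cW.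
have IJ : (I <= J)%N by move: (seed_level_small l24) (l24); clear; lia.
apply: le_trans (sum_halves R IJ).
apply: (@fail_late _ _ p p01 (2 ^ J) N (fun i => (1 / 2) ^+ i.+1) J (leqnn _) _ (J - I)%N).
- by move=> i; have /andP[] := half_itv i.+1.
- by rewrite subnKC.
- by [].
- by [].
- exact: leq_trans cW (leq_addr _ _).
- by move=> i; apply: late_level.
Qed.

(** An attempt from a fresh vertex reaches the seed level with probability
    [Q] at least 2 ^ (- l / 4), and there are 2 ^ (l / 2) restarts. *)
Lemma fail_seed_le v0 (Y : {set V}) : v0 \in Y -> #|Y| = (2 ^ (l - 1))%N ->
  fail p (2 ^ J) [set v0] (Y :\ v0) <= 52 / l%:R.
Proof.
move=> vY cY.
pose e j := (\sum_(j <= i < I) (I - i).+1 * 2 ^ i.+1)%N.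
have /andP[I0 _] := half_itv I.
have eh : (4 * e 0%N <= l)%N.
  by have := weighted_powers_le I; have := seed_level_le l24; rewrite -/(e 0%N); clear; lia.
apply: le_trans (@fail_early _ _ p p01 (2 ^ J) N (N + 2 ^ J.+1)%N I
   (fun j => (1 / 2) ^+ e j) ((1 / 2) ^+ I) (leq_addr _ _) I0 _ _ _ fail_late_le
   (2 ^ h)%N I 0%N [set v0] (Y :\ v0) _ _ _ _) _.
- by move=> j; exact: half_itv.
- by rewrite /e big_geq.
- move=> j jI; rewrite /e (big_ltn jI) exprD; apply: ler_wpM2r.
    by have /andP[] := half_itv (\sum_(j.+1 <= i < I) (I - i).+1 * 2 ^ i.+1).
  exact: early_level.
- by rewrite add0n.
- exact: disjoint_setD.
- by rewrite cards1.
- apply: leq_trans (reserve_large l24) _.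
  by move: (cardsD1 v0 Y); rewrite vY cY; clear; lia.
set Q := (1 / 2) ^+ e 0%N.
have Q01 : 0 <= Q <= 1 by exact: half_itv.
have dI : (1 / 2) ^+ I <= 48 / l%:R :> R.
  rewrite ler_pdivlMr // div1r exprVn mulrC ler_pdivrMr ?exprn_gt0 //.
  by rewrite -natrX -natrM ler_nat seed_level_ge.
have mQ : l%:R / 4 <= (2 ^ h)%:R * Q.
  have eh' : (e 0%N <= h)%N by move: eh l24; clear; lia.
  rewrite /Q natrX -(subnK eh') exprD -mulrA -exprMn (_ : 2 * (1 / 2) = 1 :> R); last by lra.
  rewrite expr1n mulr1 ler_pdivrMr // -natrX -natrM ler_nat.
  apply: (@leq_trans ((h - e 0%N).+1 * 4)%N); last by rewrite leq_mul2r /= ltn_expl.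
  by move: eh; clear; lia.
have retry : (1 - Q) ^+ (2 ^ h) <= 4 / l%:R.
  have := miss_le_inv (2 ^ h) Q01; move: mQ; set x := (2 ^ h)%:R * Q => mQ.
  have : 0 <= (1 - Q) ^+ (2 ^ h) by rewrite exprn_ge0 //; lra.
  by set q := _ ^+ _ => q0 qx; rewrite ler_pdivlMr //; nra.
have -> : 52 / l%:R = 48 / l%:R + 4 / l%:R :> R by rewrite -mulrDl; congr (_ / _); lra.
apply: lerD => //; apply: le_trans retry.
by rewrite ler_piMl ?exprn_ge0 //; lra.
Qed.

Lemma miss_all_le b t : (2 ^ J <= t)%N -> (1 - p b) ^+ t <= (1 / 2) ^+ l.*2.
Proof.
move=> tJ; apply: miss_pow2 => //; have := p_big b.
have tR : 2 ^+ J <= t%:R :> R by rewrite -natrX ler_nat.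
have -> : 2 ^+ l = 256 * 2 ^+ J :> R.
  have {1}-> : l = (8 + J)%N by move: (l24); clear; lia.
  by rewrite exprD; congr (_ * _); lra.
have /andP[p0 _] := p01 b; have := ler_wpM2r p0 tR; rewrite -mulrA -muln2 natrM.
have : 0 <= l%:R :> R by [].
lra.
Qed.

Lemma pr_not_percolates_le :
  pr (fun i : bool * edge V => p i.1) (fun S => ~~ `[< percolates (two_colours S) >])
    <= 60 / l%:R.
Proof.
have /andP[nl1 nl2] := nl.
have Yn : (2 ^ (l - 1) <= #|[set: V]|)%N.
  by rewrite cardsT (leq_trans _ nl1) // leq_exp2l // leq_subr.
pose Y := first_of (2 ^ (l - 1)) [set: V].
have cY : #|Y| = (2 ^ (l - 1))%N by exact: card_first_of.
have [v0 v0Y] : exists v0, v0 \in Y by apply/card_gt0P; rewrite cY expn_gt0.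
apply: (le_trans (not_percolates_le p01 (2 ^ J) v0Y)).
have -> : 60 / l%:R = 52 / l%:R + 8 / l%:R :> R by rewrite -mulrDl; congr (_ / _); lra.
apply: lerD; first exact: fail_seed_le.
have Yc : (2 ^ J <= #|~: Y|)%N.
  have := cardsC Y; rewrite cY => eY.
  have : (2 ^ J <= 2 ^ (l - 1))%N by rewrite leq_exp2l // leq_sub2l.
  have : (2 ^ l = 2 * 2 ^ (l - 1))%N by rewrite -expnS; congr (_ ^ _)%N; move: (l24); clear; lia.
  by move: nl1 eY; clear; lia.
set x := (1 / 2 : R) ^+ l.*2; have /andP[x0 _] := half_itv l.*2; rewrite -/x in x0.
have nY : #|Y|%:R + #|~: Y|%:R <= 2 * 2 ^+ l :> R.
  by rewrite -natrX -natrM -natrD ler_nat cardsC -expnS ltnW.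
have := miss_all_le true (leqnn _); have := miss_all_le false (leqnn _).
have := miss_all_le true Yc; have := miss_all_le false Yc; rewrite -/x.
set a1 := _ ^+ _; set a2 := _ ^+ _; set a3 := _ ^+ _; set a4 := _ ^+ _ => h1 h2 h3 h4.
apply: (@le_trans _ _ (2 * 2 ^+ l * (2 * x))).
  apply: (@le_trans _ _ ((#|Y|%:R + #|~: Y|%:R) * (2 * x))); last first.
    by rewrite ler_wpM2r // mulr_ge0.
  rewrite [leRHS]mulrDl addrC; apply: lerD; rewrite ler_wpM2l //; lra.
rewrite ler_pdivlMr //.
have -> : x = (1 / 2) ^+ l * (1 / 2) ^+ l by rewrite -exprD addnn.
have M1 : 2 ^+ l * (1 / 2) ^+ l = 1 :> R.
  by rewrite -exprMn (_ : 2 * (1 / 2) = 1 :> R) ?expr1n //; lra.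
have lM : l%:R <= 2 ^+ l :> R by rewrite -natrX ler_nat ltnW // ltn_expl.
set M := 2 ^+ l in M1 lM *; set q := (1 / 2) ^+ l in M1 *.
have -> : 2 * M * (2 * (q * q)) * l%:R = 4 * (M * q) * (q * l%:R) by ring.
rewrite M1; have /andP[q0 _] := half_itv l; rewrite -/q in q0.
have := ler_wpM2l q0 lM; rewrite [q * M]mulrC M1; lra.
Qed.

End Supercritical.

(** * Asymptotics *)

Lemma gnp2_probE (R : realType) n (p1 p2 : R) (Q : double_graph -> Prop) :
  gnp2_prob n p1 p2 Q =
  pr (fun i : bool * edge 'I_n => if i.1 then p1 else p2)
     (fun S => `[< Q (two_colours S) >]).
Proof.
pose glue (E : {set edge 'I_n} * {set edge 'I_n}) : {set bool * edge 'I_n} :=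
  [set i | if i.1 then i.2 \in E.1 else i.2 \in E.2].
pose cut (S : {set bool * edge 'I_n}) := (colour true S, colour false S).
have cutK : cancel cut glue.
  by move=> S; apply/setP => -[[] e]; rewrite !inE.
have glueK : cancel glue cut.
  by case=> E1 E2; congr (_, _); apply/setP => e; rewrite !inE.
rewrite /gnp2_prob (reindex cut) /=; last by exists glue => S _; [exact: cutK|exact: glueK].
rewrite big_mkcond; apply: eq_bigr => S _.
case: ifP => _; last by rewrite mulr0.
pose w b e := if (b, e) \in S then if b then p1 else p2
              else 1 - (if b then p1 else p2).
have -> : bweight (fun i : bool * edge 'I_n => if i.1 then p1 else p2) S
    = \prod_b \prod_e w b e.
  by rewrite pair_bigA; apply: eq_bigr => -[].
by rewrite mulr1 big_bool /w; congr (_ * _); apply: eq_bigr => e _; rewrite inE.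
Qed.

Import numFieldNormedType.Exports.
Local Open Scope classical_set_scope.
Local Open Scope ring_scope.

Lemma ln2_itv (R : realType) : 1 / 2 <= ln (2 : R) <= 1.
Proof.
apply/andP; split.
  have := @le_ln1Dx R (- (1 / 2)) ltac:(lra).
  rewrite (_ : 1 + - (1 / 2) = 2^-1 :> R); last by field.
  by rewrite lnV ?posrE //; lra.
have := @le_ln1Dx R 1 ltac:(lra).
by rewrite (_ : 1 + 1 = 2 :> R) //; ring.
Qed.

Lemma ln_trunc_log (R : realType) n (l := trunc_log 2 n) : (2 <= n)%N ->
  l%:R <= 2 * ln n%:R :> R /\ ln n%:R <= 2 * l%:R :> R.
Proof.
move=> n2; have /andP[h1 h2] := ln2_itv R.
have n0 : (0 < n)%N by apply: leq_trans n2.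
have l1 : (0 < l)%N by rewrite trunc_log_gt0.
have lR : 1 <= l%:R :> R by rewrite ler1n.
have up : ln n%:R <= ln ((2 : R) ^+ l.+1).
  by rewrite ler_ln ?posrE ?ltr0n ?exprn_gt0 // -natrX ler_nat ltnW // trunc_log_ltn.
have lo : ln ((2 : R) ^+ l) <= ln n%:R.
  by rewrite ler_ln ?posrE ?ltr0n ?exprn_gt0 // -natrX ler_nat trunc_logP.
rewrite !lnXn // -!(mulr_natl (ln 2)) -natr1 in up lo.
by split; nra.
Qed.

(** Both parts of the theorem are proved with this rate of convergence. *)
Lemma cvg_trunc_log (R : realType) (u : nat -> R) (a C : R) :
  (\forall n \near \oo, `|a - u n| <= C / (trunc_log 2 n)%:R) ->
  u n @[n --> \oo] --> a.
Proof.
move=> uC; apply/cvgrPdist_le => e e0.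
pose k := (Num.trunc (`|C| / e)).+1.
have kC : `|C| <= e * k%:R.
  by rewrite mulrC -ler_pdivrMr // ltW // /k truncnS_gt.
near=> n.
have nk : (k <= trunc_log 2 n)%N.
  have n2 : (2 ^ k <= n)%N by near: n; exact: nbhs_infty_ge.
  by rewrite -(trunc_expnK k (isT : 1 < 2)%N) leq_trunc_log.
have l0 : 0 < (trunc_log 2 n)%:R :> R by rewrite ltr0n (leq_trans _ nk).
apply: (@le_trans _ _ (C / (trunc_log 2 n)%:R)); first by near: n.
rewrite ler_pdivrMr //; apply: le_trans (ler_norm C) (le_trans kC _).
by rewrite ler_wpM2l ?ler_nat // ltW.
Unshelve. all: by end_near.
Qed.

Lemma gnp2_subcritical (R : realType) n (p1 p2 c : R) :
  (4 <= n)%N -> 0 <= p1 <= 1 -> 0 <= p2 <= 1 -> 256 <= c ->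
  p1 * p2 <= 1 / (c * n%:R * ln n%:R) ->
  gnp2_prob n p1 p2 percolates <= 128 / (trunc_log 2 n)%:R.
Proof.
move=> n4 h1 h2 c256 s_small; have n2 : (2 <= n)%N by apply: leq_trans n4.
have n0 : (0 < n)%N by apply: leq_trans n4.
have [lnl _] := ln_trunc_log R n2.
set l := trunc_log 2 n in lnl *.
have l2 : (2 <= l)%N by rewrite /l -(trunc_expnK 2 (isT : 1 < 2)%N) leq_trunc_log.
have l0 : 0 < l%:R :> R by rewrite ltr0n (leq_trans _ l2).
have nR : 0 < n%:R :> R by rewrite ltr0n.
have ln0 : 0 < ln (n%:R : R) by rewrite ln_gt0 // ltr1n.
pose p b := if b then p1 else p2.
have p01 b : 0 <= p b <= 1 by rewrite /p; case: b.
have sparse : 8 * l%:R * n%:R * (p true * p false) <= 1 / 16.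
  have /andP[p10 _] := h1; have /andP[p20 _] := h2.
  have c0 : 0 < c by apply: lt_le_trans c256; rewrite ltr0n.
  have s0 : 0 <= n%:R * (p1 * p2) by rewrite !mulr_ge0.
  have X0 : 0 <= n%:R * (p1 * p2) * ln n%:R by rewrite mulr_ge0 // ltW.
  rewrite ler_pdivlMr ?mulr_gt0 // in s_small.
  have cX : 256 * (n%:R * (p1 * p2) * ln n%:R) <= 1.
    apply: le_trans (ler_wpM2r X0 c256) (le_trans _ s_small).
    by rewrite le_eqVlt; apply/orP; left; apply/eqP; ring.
  rewrite /p (_ : 8 * _ * _ * _ = 8 * (n%:R * (p1 * p2) * l%:R)); last by ring.
  by have := ler_wpM2l s0 lnl; move=> {s_small c256}; lra.
have lV : (l <= #|'I_n|)%N.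
  rewrite card_ord; apply: leq_trans (trunc_logP (isT : 1 < 2)%N n0).
  by rewrite ltnW // ltn_expl.
rewrite gnp2_probE.
have := pr_percolates_le p01 l2 lV; rewrite card_ord => /(_ sparse)/le_trans; apply.
have n2l : n%:R <= 2 * 2 ^+ l :> R.
  by rewrite -natrX -natrM ler_nat -expnS ltnW // trunc_log_ltn.
have lM : l%:R <= 2 ^+ l :> R by rewrite -natrX ler_nat ltnW // ltn_expl.
(* Two factors [l] and the factor [n], each at most of order 2 ^ l, are absorbed
   by 16 ^ (l - 1). *)
have M16 : 2 ^+ l * (2 ^+ l * 2 ^+ l) <= 16 * 16 ^+ l.-1 :> R.
  rewrite -exprS prednK ?(ltnW l2) // (_ : 16 = 2 * (2 * (2 * 2)) :> R); last by ring.
  rewrite !exprMn !ler_wpM2l ?exprn_ge0 //.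
  by rewrite -[leLHS]mulr1 ler_wpM2l ?exprn_ge0 // exprn_ege1 // ler1n.
have D0 : 0 < (16 : R) ^+ l.-1 by rewrite exprn_gt0.
rewrite ler_pdivlMr // mulrAC mulrA ler_pdivrMr //.
set D := 16 ^+ l.-1 in D0 M16 *; set M := 2 ^+ l in lM n2l M16.
apply: (@le_trans _ _ (M * M * (4 * (2 * M)))).
  apply: ler_pM; rewrite ?mulr_ge0 //; first by rewrite ler_pM //.
  by rewrite ler_wpM2l.
have -> : M * M * (4 * (2 * M)) = 8 * (M * (M * M)) by ring.
by move=> {sparse s_small c256}; lra.
Qed.

Lemma gnp2_supercritical (R : realType) n (p1 p2 c : R) :
  (2 ^ 24 <= n)%N -> 0 <= p1 <= 1 -> 0 <= p2 <= 1 ->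
  4 * 512 <= c -> 4 * (128 * 48) <= c ->
  c / (n%:R * ln n%:R) <= p1 * p2 ->
  c * ln n%:R / n%:R <= Num.min p1 p2 ->
  1 - gnp2_prob n p1 p2 percolates <= 60 / (trunc_log 2 n)%:R.
Proof.
move=> n24 h1 h2 c512 c6144 pp_large p_large.
have n2 : (2 <= n)%N by apply: leq_trans n24; rewrite -{1}(expn1 2) leq_exp2l.
have n0 : (0 < n)%N by apply: leq_trans n2.
have nR : 0 < n%:R :> R by rewrite ltr0n.
have ln0 : 0 < ln (n%:R : R) by rewrite ln_gt0 // ltr1n.
have [lnl lnu] := ln_trunc_log R n2.
set l := trunc_log 2 n in lnl lnu *.
have l24 : (24 <= l)%N by rewrite /l -(trunc_expnK 24 (isT : 1 < 2)%N) leq_trunc_log.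
have nl : (2 ^ l <= #|'I_n| < 2 ^ l.+1)%N by rewrite card_ord trunc_logP // trunc_log_ltn.
have n2l : n%:R <= 2 * 2 ^+ l :> R.
  by rewrite -natrX -natrM ler_nat -expnS ltnW // trunc_log_ltn.
pose p b := if b then p1 else p2.
have p01 b : 0 <= p b <= 1 by rewrite /p; case: b.
have pb b : 512 * l%:R <= 2 ^+ l * p b.
  have pn : c * ln n%:R / n%:R <= p b.
    by apply: le_trans p_large _; rewrite /p ge_min; case: b; rewrite lexx ?orbT.
  rewrite ler_pdivrMr // in pn; have /andP[pb0 _] := p01 b.
  have := le_trans (ler_wpM2r (ltW ln0) c512) (le_trans pn (ler_wpM2l pb0 n2l)).
  by move=> {c512 c6144 pp_large p_large pn}; lra.
have pp : 128 * 48 <= l%:R * (2 ^+ l * (p true * p false)).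
  rewrite ler_pdivrMr ?mulr_gt0 // in pp_large.
  have /andP[p10 _] := h1; have /andP[p20 _] := h2.
  have s0 : 0 <= p1 * p2 by rewrite mulr_ge0.
  have : 4 * (128 * 48) <= 4 * (l%:R * (2 ^+ l * (p true * p false))).
    apply: (le_trans c6144); apply: (le_trans pp_large); rewrite /p.
    rewrite [leRHS](_ : _ = p1 * p2 * (2 * 2 ^+ l * (2 * l%:R))); last by ring.
    by rewrite ler_wpM2l // ler_pM // ltW.
  by rewrite ler_pM2l // ltr0n.
rewrite gnp2_probE -(pr_compl (fun i : bool * edge 'I_n => if i.1 then p1 else p2)).
exact: (pr_not_percolates_le p01 l24 nl pb pp).
Qed.

Theorem theorem2 (R : realType) :
  exists2 c : R, 0 < c &
    forall p1 p2 : nat -> R,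
      (forall n : nat, 0 <= p1 n <= 1) ->
      (forall n : nat, 0 <= p2 n <= 1) ->
      ((\forall n \near \oo, p1 n * p2 n <= 1 / (c * n%:R * ln n%:R)) ->
       gnp2_prob n (p1 n) (p2 n) percolates @[n --> \oo] --> (0 : R))
      /\
      ((\forall n \near \oo, c / (n%:R * ln n%:R) <= p1 n * p2 n) ->
       (\forall n \near \oo, c * ln n%:R / n%:R <= Num.min (p1 n) (p2 n)) ->
       gnp2_prob n (p1 n) (p2 n) percolates @[n --> \oo] --> (1 : R)).
Proof.
(* The factor 4 pays for replacing [n] by [2 ^+ l] and [ln n] by [l], each up to
   a factor 2; 128 * 48 is what the levels next to the seed level need. *)
pose c : R := 4 * (128 * 48).
have [c0 c256 c512] : [/\ 0 < c, 256 <= c & 4 * 512 <= c] by rewrite /c; split; lra.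
exists c => // p1 p2 h1 h2.
have prob01 n : 0 <= gnp2_prob n (p1 n) (p2 n) percolates <= 1.
  by rewrite gnp2_probE pr_ge0 ?pr_le1 // => i; case: ifP.
split=> [small|large1 large2].
  apply: (@cvg_trunc_log _ _ _ 128); near=> n.
  have /andP[P0 _] := prob01 n; rewrite sub0r normrN ger0_norm //.
  apply: (gnp2_subcritical _ (h1 n) (h2 n) c256); near: n; last exact: small.
  exact: nbhs_infty_ge.
apply: (@cvg_trunc_log _ _ _ 60); near=> n.
have /andP[_ P1] := prob01 n; rewrite ger0_norm ?subr_ge0 //.
apply: (gnp2_supercritical _ (h1 n) (h2 n) c512 (lexx c)); near: n => //.
exact: nbhs_infty_ge.
Unshelve. all: by end_near.
Qed.
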